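(* For each of the two passenger responses (Linear and MinImprov) and each fixed $k\in\mathbb N_{\ge1}$ (not part of the input), the bi-objective BRT investment problem $\textsc{BRT}(\star/Z=k/|M|\ge1)$ can be solved in polynomial time, i.e. the set of all non-dominated points of an instance can be computed in polynomial time.
   Context: An instance consists of: a linear graph $G=(V,E)$ with $V=\{1,\dots,n\}$, $n\in\mathbb N_{\ge1}$ (stations) and $E=\{e_i=\{i,i+1\}: i\in\{1,\dots,n-1\}\}$ (segments); upgrade costs $c_e\in\mathbb N_{\ge1}$ for $e\in E$; a finite set $M$ of municipalities with pairwise disjoint sets $E_m\subseteq E$ of consecutive segments, $\bigcup_{m\in M}E_m=E$; budget shares $b_m\in\mathbb R_{>0}$ with $\sum_{m\in M}b_m=1$; a set of OD pairs $D\subseteq\{(i,j):i,j\in V,i\neq j\}$, where $W_d\subseteq E$ denotes the edge set of the unique path from $i$ to $j$ in $G$ for $d=(i,j)\in D$; numbers of potential passengers $a_d\in\mathbb N_{\ge1}$ for $d\in D$; infrastructure improvements $u_e\in\mathbb R_{>0}$ for $e\in E$; and, for MinImprov, thresholds $L_d\in\mathbb R_{\ge0}$ with $L_d\le\sum_{e\in W_d}u_e$ for $d\in D$. For $F\subseteq E$ the number of newly attracted passengers is $p(F)=\sum_{d\in D}p_d(F)$, where in Linear $p_d(F)=a_d\cdot\frac{\sum_{e\in F\cap W_d}u_e}{\sum_{e\in W_d}u_e}$, and in MinImprov $p_d(F)=a_d$ if $L_d\le\sum_{e\in F\cap W_d}u_e$ and $p_d(F)=0$ otherwise. A pair $(F,v)$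 with $F\subseteq E$, $v\in\mathbb R_{\ge0}$ is feasible for $Z=k$ if $\sum_{e\in F\cap E_m}c_e\le b_m v$ for all $m\in M$ and the subgraph $G[F]$ consisting of the edges in $F$ and their incident nodes has at most $k$ connected components. The problem is to maximize $p(F)$ and minimize $v$ over feasible $(F,v)$. The point $(p(F),v)$ of a feasible $(F,v)$ is non-dominated if there is no feasible $(F',v')$ with $p(F')\ge p(F)$, $v'\le v$ and at least one inequality strict. *)

(* Defs.v *)
(* MathComp world; the reals are a MathComp-Analysis [realType]. *)
From HB Require Import structures.
From mathcomp Require Import all_boot all_order all_algebra.
From mathcomp Require Import reals.
From mathcomp Require Import zify.

Set Implicit Arguments.
Unset Strict Implicit.
Unset Printing Implicit Defensive.

Import Order.TTheory GRing.Theory Num.Theory.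

(** * Linear graphs *)

(* Stations are numbered from 0: the stations are ['I_n.+1] (so there is at
   least one), the segments ['I_n], and segment [e] is the edge {e, e+1}. *)
Section LinearGraph.
Variable n : nat.
Implicit Types (e : 'I_n) (F : {set 'I_n}) (x y : 'I_n.+1) (p : seq 'I_n.+1).

Definition joins e x y : bool :=
  (x == e :> nat) && (y == e.+1 :> nat) || (y == e :> nat) && (x == e.+1 :> nat).

Definition adj F : rel 'I_n.+1 := fun x y => [exists e in F, joins e x y].

Definition incident F : {set 'I_n.+1} :=
  [set x | [exists y, adj F x y]].

Definition components F : nat := n_comp (adj F) (incident F).

(* Edge set of the unique path between the two stations of [d]; see
   [route_path]. *)
Definition route (d : 'I_n.+1 * 'I_n.+1) : {set 'I_n} :=
  [set e : 'I_n | minn d.1 d.2 <= e < maxn d.1 d.2].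

Definition consecutive F : Prop :=
  forall e1 e e2, e1 \in F -> e2 \in F -> e1 <= e <= e2 -> e \in F.

Fixpoint walk_edges x p : {set 'I_n} :=
  if p is y :: p' then [set e | joins e x y] :|: walk_edges y p' else set0.

Lemma adj_step F x y :
  adj F x y -> y = x.+1 :> nat \/ x = y.+1 :> nat.
Proof.
case/existsP=> e /andP[_ /orP[] /andP[/eqP h1 /eqP h2]]; [left|right]; lia.
Qed.

Lemma path_same_side F x y p :
  path (adj F) y p -> x \notin y :: p -> (x < last y p) = (x < y).
Proof.
elim: p y => //= z p IH y /andP[/adj_step yz zp].
rewrite in_cons negb_or => /andP[xy xzp]; rewrite IH //.
have xz : x != z by move: xzp; rewrite in_cons negb_or => /andP[].
move: xy xz; rewrite -!val_eqE /=; lia.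
Qed.

Lemma route_path x y p :
    path (adj [set: 'I_n]) x p -> uniq (x :: p) -> last x p = y ->
  walk_edges x p = route (x, y).
Proof.
move=> + + <-; elim: p x => [|z p IH] x /=.
  by move=> _ _; apply/setP=> e; rewrite !inE /=; lia.
move=> /andP[/adj_step xz zp] /andP[xzp uzp].
rewrite IH //; apply/setP=> e; rewrite !inE /= /joins.
have := path_same_side zp xzp.
have : x != last z p by apply: contraNneq xzp => ->; apply: mem_last.
rewrite -val_eqE /=; lia.
Qed.

End LinearGraph.

Local Open Scope ring_scope.

(** * The investment problem *)

Inductive response := Linear | MinImprov.

(* Raw data of an instance with numeric data in [K]. The values of [demand]
   and [threshold] outside [od], and [threshold] as a whole for [Linear], are
   irrelevant. *)
Record instance (K : Type) := Instance {
  nseg : nat;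
  nmun : nat;
  cost : 'I_nseg -> nat;
  seg : 'I_nmun -> {set 'I_nseg};
  share : 'I_nmun -> K;
  od : {set 'I_nseg.+1 * 'I_nseg.+1};
  demand : 'I_nseg.+1 * 'I_nseg.+1 -> nat;
  improvement : 'I_nseg -> K;
  threshold : 'I_nseg.+1 * 'I_nseg.+1 -> K
}.

Definition map_instance (K K' : Type) (f : K -> K') (I : instance K) :
    instance K' :=
  @Instance K' (nseg I) (nmun I) (@cost K I) (@seg K I)
    (fun m => f (share m)) (od I) (@demand K I)
    (fun e => f (improvement e)) (fun d => f (threshold d)).

Section Problem.
Variables (R : realFieldType) (resp : response) (k : nat) (I : instance R).
Implicit Types (F : {set 'I_(nseg I)}) (v : R).

Record valid : Prop := Valid {
  valid_cost : forall e : 'I_(nseg I), (0 < cost e)%N;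
  valid_seg_consecutive : forall m : 'I_(nmun I), consecutive (seg m);
  valid_seg_disjoint :
    forall m m' : 'I_(nmun I), m != m' -> [disjoint seg m & seg m'];
  valid_seg_cover : \bigcup_(m < nmun I) seg m = [set: 'I_(nseg I)];
  valid_share : forall m : 'I_(nmun I), 0 < share m;
  valid_share_sum : \sum_(m < nmun I) share m = 1;
  valid_od : forall d, d \in od I -> d.1 != d.2;
  valid_demand : forall d, d \in od I -> (0 < demand d)%N;
  valid_improvement : forall e : 'I_(nseg I), 0 < improvement e;
  valid_threshold : resp = MinImprov -> forall d, d \in od I ->
    0 <= threshold d <= \sum_(e in route d) improvement e
}.

Definition passengers_od F (d : 'I_(nseg I).+1 * 'I_(nseg I).+1) : R :=
  match resp with
  | Linear =>
      (demand d)%:R * ((\sum_(e in F :&: route d) improvement e)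
                       / (\sum_(e in route d) improvement e))
  | MinImprov =>
      if threshold d <= \sum_(e in F :&: route d) improvement e
      then (demand d)%:R else 0
  end.

Definition passengers F : R := \sum_(d in od I) passengers_od F d.

Definition feasible F v : Prop :=
  [/\ 0 <= v,
      forall m : 'I_(nmun I),
        (\sum_(e in F :&: seg m) cost e)%:R <= share m * v
    & (components F <= k)%N].

Definition nondominated_point (z : R * R) : Prop :=
  exists F v,
    [/\ feasible F v,
        z = (passengers F, v)
      & ~ exists F' v',
          [/\ feasible F' v', passengers F <= passengers F', v' <= v
            & passengers F < passengers F' \/ v' < v]].

End Problem.

(** * Random access machines over an ordered field *)

(* A machine has a memory of natural numbers, used for indices and counters,
   and a memory of elements of [K]; both are addressed by index expressions.
   Values of [K] can only be combined by field operations and compared; there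
   is no rounding and no conversion from [K] to [nat], and the only constants
   of [K] are 0 and 1. *)
Inductive iexp :=
  | IConst of nat
  | IGet of iexp
  | IAdd of iexp & iexp
  | ISub of iexp & iexp.

Inductive rexp :=
  | RZero
  | ROne
  | RGet of iexp
  | RAdd of rexp & rexp
  | RSub of rexp & rexp
  | RMul of rexp & rexp
  | RDiv of rexp & rexp.

Inductive test :=
  | ILe of iexp & iexp
  | RLe of rexp & rexp.

Inductive cmd :=
  | Skip
  | ISet of iexp & iexp  (* address, value *)
  | RSet of iexp & rexp  (* address, value *)
  | Seq of cmd & cmd
  | If of test & cmd & cmd
  | While of test & cmd.

Section Machine.
(* [sz] is the size of an element of [K]: constantly 1 gives the unit-cost
   model, the length of a binary encoding gives the logarithmic-cost model. *)
Variables (K : realFieldType) (sz : K -> nat).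

Record state := State { imem : nat -> nat; rmem : nat -> K }.

Definition update (T : Type) (m : nat -> T) (a : nat) (x : T) : nat -> T :=
  fun b => if b == a then x else m b.

Fixpoint ieval (s : state) (e : iexp) : nat :=
  match e with
  | IConst c => c
  | IGet a => imem s (ieval s a)
  | IAdd e1 e2 => (ieval s e1 + ieval s e2)%N
  | ISub e1 e2 => (ieval s e1 - ieval s e2)%N
  end.

(* Index operations have unit cost. Since indices are only added and
   subtracted, one operation increases the maximal bit length of the indices
   by at most one, so that this is polynomially equivalent to charging bit
   lengths. *)
Fixpoint icost (e : iexp) : nat :=
  match e with
  | IConst _ => 1
  | IGet a => (icost a).+1
  | IAdd e1 e2 | ISub e1 e2 => (icost e1 + icost e2).+1
  end.

Fixpoint reval (s : state) (e : rexp) : K :=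
  match e with
  | RZero => 0
  | ROne => 1
  | RGet a => rmem s (ieval s a)
  | RAdd e1 e2 => reval s e1 + reval s e2
  | RSub e1 e2 => reval s e1 - reval s e2
  | RMul e1 e2 => reval s e1 * reval s e2
  | RDiv e1 e2 => reval s e1 / reval s e2
  end.

(* Every subexpression is charged the size of its value, so that an operation
   pays for its operands and for its result. *)
Fixpoint rcost (s : state) (e : rexp) : nat :=
  (sz (reval s e) +
   match e with
   | RZero | ROne => 1
   | RGet a => (icost a).+1
   | RAdd e1 e2 | RSub e1 e2 | RMul e1 e2 | RDiv e1 e2 =>
       (rcost s e1 + rcost s e2).+1
   end)%N.

Definition teval (s : state) (t : test) : bool :=
  match t with
  | ILe e1 e2 => (ieval s e1 <= ieval s e2)%N
  | RLe e1 e2 => reval s e1 <= reval s e2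
  end.

Definition tcost (s : state) (t : test) : nat :=
  match t with
  | ILe e1 e2 => (icost e1 + icost e2).+1
  | RLe e1 e2 => (rcost s e1 + rcost s e2).+1
  end.

(* [exec c s t s']: started in [s], the program [c] halts in [s'] after a
   computation of cost [t]. *)
Inductive exec : cmd -> state -> nat -> state -> Prop :=
  | ExecSkip s : exec Skip s 1 s
  | ExecISet s a e :
      exec (ISet a e) s (icost a + icost e).+1
        (State (update (imem s) (ieval s a) (ieval s e)) (rmem s))
  | ExecRSet s a e :
      exec (RSet a e) s (icost a + rcost s e).+1
        (State (imem s) (update (rmem s) (ieval s a) (reval s e)))
  | ExecSeq c1 c2 s1 s2 s3 t1 t2 :
      exec c1 s1 t1 s2 -> exec c2 s2 t2 s3 ->
      exec (Seq c1 c2) s1 (t1 + t2).+1 s3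
  | ExecIf b c1 c2 s t s' :
      exec (if teval s b then c1 else c2) s t s' ->
      exec (If b c1 c2) s (tcost s b + t).+1 s'
  | ExecWhileEnd b c s :
      ~~ teval s b -> exec (While b c) s (tcost s b).+1 s
  | ExecWhileStep b c s1 s2 s3 t1 t2 :
      teval s1 b -> exec c s1 t1 s2 -> exec (While b c) s2 t2 s3 ->
      exec (While b c) s1 (tcost s1 b + t1 + t2).+1 s3.

Definition load (si : seq nat) (sr : seq K) : state :=
  State (nth 0%N si) (nth 0 sr).

(* On halting, index cell 0 holds the number of output points and index cell 1
   the address in the memory of [K] from which their coordinates are listed. *)
Definition output (s : state) : seq (K * K) :=
  [seq (rmem s (imem s 1 + 2 * i)%N, rmem s (imem s 1 + 2 * i + 1)%N)
  | i <- iota 0 (imem s 0)].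

End Machine.

(** * Encoding of instances and polynomial-time solvability *)

Section Encoding.
Variables (K : realFieldType) (resp : response) (I : instance K).

(* The sets of segments of a valid instance partition the segments and are
   given by the municipality of each segment. *)
Definition municipality (e : 'I_(nseg I)) : nat :=
  find (fun m : 'I_(nmun I) => e \in seg m) (enum 'I_(nmun I)).

Definition index_input : seq nat :=
  [:: (nseg I).+1; nmun I; #|od I|]
  ++ [seq municipality e | e <- enum 'I_(nseg I)]
  ++ flatten [seq [:: nat_of_ord d.1; nat_of_ord d.2] | d <- enum (od I)].

Definition number_input : seq K :=
  [seq (cost e)%:R | e <- enum 'I_(nseg I)]
  ++ [seq improvement e | e <- enum 'I_(nseg I)]
  ++ [seq share m | m <- enum 'I_(nmun I)]
  ++ [seq (demand d)%:R | d <- enum (od I)]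
  ++ (if resp is MinImprov then [seq threshold d | d <- enum (od I)] else [::]).

Definition input_state : state K := load index_input number_input.

(* The integers of [index_input] are bounded by the length of the input, so
   counting one for each of them is polynomially equivalent to counting their
   bits. *)
Definition input_size (sz : K -> nat) : nat :=
  (size index_input + \sum_(x <- number_input) sz x)%N.

End Encoding.

(* [P] computes the duplicate-free list of all non-dominated points, on all
   instances whose numeric data lie in the subfield [K] of [R], within a cost
   polynomial in the input size. *)
Definition solves_in_poly_time (R K : realFieldType) (f : K -> R)
    (sz : K -> nat) (resp : response) (k : nat) (P : cmd) : Prop :=
  exists a b : nat, forall I : instance K, valid resp (map_instance f I) ->
    exists (t : nat) (s : state K),
      [/\ exec sz P (input_state resp I) t s,
          (t <= a * input_size resp I sz ^ b)%N,
          uniq (output s)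
        & forall z : R * R,
            nondominated_point resp k (map_instance f I) z <->
            z \in [seq (f y.1, f y.2) | y <- output s]].

Definition bits (m : nat) : nat := (trunc_log 2 m).+1.

Definition rat_bits (x : rat) : nat :=
  (bits `|numq x|%N + bits `|denq x|%N)%N.

(* Main.v *)
(* A set of segments has at most k components iff it is a union of k intervals,
   so for fixed k there are only (n+1)^(2k) candidates F. The least feasible
   budget of F is max_m c(F & E_m) / b_m, and the non-dominated points are the
   Pareto-optimal ones among the pairs of p(F) and this budget. Hence 2k nested
   loops listing all pairs, followed by a pairwise comparison, suffice.
   For the bit cost, each number computed is an expression with polynomially
   many field operations in the input, and the height of rationals (essentially
   the bit length of the larger of numerator and denominator) is subadditive
   for each of the four operations. *)
Require Import Defs.
From Stdlib Require Import FunctionalExtensionality.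
From mathcomp Require Import all_boot all_order all_algebra.
From mathcomp Require Import reals.
From mathcomp Require Import zify.

Set Implicit Arguments.
Unset Strict Implicit.
Unset Printing Implicit Defensive.

Import Order.TTheory GRing.Theory Num.Theory.

(** Counting field operations along an execution does not bound bit lengths: a loop that keeps
    squaring one cell performs few operations but produces exponentially long values. Therefore
    every value written is identified with an explicit formula in the input (a partial sum, a
    quotient, a maximum), and its height is bounded from that formula; one common bound [B] on all
    cells is carried through every rule of a small program logic. With [B] and a bound [L] on the
    iterations of each loop, the cost can be read off from the syntax. Height and charged size have
    to be kept apart, because [rat_bits] is not subadditive: 4 and 1/8 have sizes 4 and 5, but 33/8
    has size 10. Axiomatizing heights also lets both cost models share one proof, the unit-cost
    model having constant height 1. Two further obstacles: budgets range over [R] while the machine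
    computes in [K], and the result must be announced in cells that hold the input. *)

(** * Heights of numbers for the two cost models *)

Record height (K : realFieldType) (sz h : K -> nat) : Prop := Height {
  height0 : (h 0%R <= 1)%N;
  height1 : (h 1%R <= 1)%N;
  heightD : forall x y, (h (x + y)%R <= h x + h y)%N;
  heightB : forall x y, (h (x - y)%R <= h x + h y)%N;
  heightM : forall x y, (h (x * y)%R <= h x + h y)%N;
  height_div : forall x y, (h (x / y)%R <= h x + h y)%N;
  size_gt0 : forall x, (0 < sz x)%N;
  size_le_height : forall x, (sz x <= 2 * h x)%N;
  height_le_size : forall x, (h x <= 2 * sz x)%N
}.

Lemma unit_height_spec (K : realFieldType) : @height K (fun=> 1%N) (fun=> 1%N).
Proof. by split. Qed.

Definition rat_max (x : rat) : nat := maxn `|numq x|%N `|denq x|%N.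

(** The [.+1] pays for the factor 2 in [rat_maxD]: it gives [2 * rat_max x <= 2 ^ rat_height x], and
    this form is stable under sums as well as products. *)
Definition rat_height (x : rat) : nat := (up_log 2 (rat_max x)).+1.

(** Reducing a fraction only shrinks numerator and denominator, so unreduced fractions may be used
    in estimates. The 1 covers the denominator 0, where the quotient is 0 = 0/1. *)
Lemma rat_max_div (n d : int) :
  (rat_max (n%:Q / d%:Q)%R <= maxn (maxn `|n|%N `|d|%N) 1)%N.
Proof.
case: divqP => [|k x k0]; first by move=> _; rewrite /rat_max /= leq_maxr.
rewrite /rat_max !abszM; have : (0 < `|k|)%N by rewrite absz_gt0.
nia.
Qed.

Lemma rat_max_gt0 x : (0 < rat_max x)%N.
Proof. by rewrite /rat_max leq_max !absz_gt0 denq_neq0 orbT. Qed.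

Lemma rat_max_le (n d : int) (m : nat) :
  (`|n| <= m -> `|d| <= m -> 0 < m -> rat_max (n%:Q / d%:Q)%R <= m)%N.
Proof.
move=> hn hd hm; apply: leq_trans (rat_max_div n d) _.
by rewrite !geq_max hn hd hm.
Qed.

Lemma absz_rat_max x : (`|numq x| <= rat_max x /\ `|denq x| <= rat_max x)%N.
Proof. by rewrite /rat_max leq_maxl leq_maxr. Qed.

Lemma rat_maxD x y : (rat_max (x + y)%R <= 2 * (rat_max x * rat_max y))%N.
Proof.
have [nx dx] := absz_rat_max x; have [ny dy] := absz_rat_max y.
rewrite -{1}[x]divq_num_den -{1}[y]divq_num_den addf_div ?intr_eq0 ?denq_neq0 //.
rewrite -!intrM -intrD; apply: rat_max_le.
- by have := rat_max_gt0 x; have := rat_max_gt0 y; nia.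
- by have := rat_max_gt0 x; have := rat_max_gt0 y; nia.
- by have := rat_max_gt0 x; have := rat_max_gt0 y; nia.
Qed.

Lemma rat_maxM x y : (rat_max (x * y)%R <= rat_max x * rat_max y)%N.
Proof.
have [nx dx] := absz_rat_max x; have [ny dy] := absz_rat_max y.
rewrite -{1}[x]divq_num_den -{1}[y]divq_num_den mulf_div -!intrM.
by apply: rat_max_le; rewrite ?abszM ?leq_mul // muln_gt0 !rat_max_gt0.
Qed.

Lemma rat_maxV x : (rat_max x^-1%R <= rat_max x)%N.
Proof.
have [nx dx] := absz_rat_max x.
rewrite -{1}[x]divq_num_den invf_div.
by apply: rat_max_le; rewrite ?rat_max_gt0.
Qed.

Lemma rat_maxN x : rat_max (- x)%R = rat_max x.
Proof. by rewrite /rat_max numqN denqN abszN. Qed.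

Lemma rat_max_height x : (2 * rat_max x <= 2 ^ rat_height x)%N.
Proof. by rewrite expnS leq_mul2l up_logP. Qed.

Lemma rat_height_le x m : (2 * rat_max x <= 2 ^ m -> rat_height x <= m)%N.
Proof.
case: m => [|m]; first by have := rat_max_gt0 x; rewrite expn0; lia.
by rewrite expnS leq_mul2l /= => h; rewrite /rat_height ltnS up_log_min.
Qed.

Lemma rat_height_spec : height rat_bits rat_height.
Proof.
(* One criterion for all four operations: [2 * rat_max z] is at most the product of [2 * rat_max x]
   and [2 * rat_max y]. *)
have addP (x y z : rat) : (rat_max z <= 2 * (rat_max x * rat_max y) ->
    rat_height z <= rat_height x + rat_height y)%N.
  move=> hz; apply: rat_height_le; rewrite expnD.
  by have := rat_max_height x; have := rat_max_height y; nia.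
split=> [||x y|x y|x y|x y|x|x|x].
- by rewrite /rat_height /rat_max.
- by rewrite /rat_height /rat_max.
- by apply: addP; apply: rat_maxD.
- by apply: addP; rewrite -(rat_maxN y); apply: rat_maxD.
- by apply: addP; apply: leq_trans (rat_maxM x y) _; lia.
- apply: addP; apply: leq_trans (rat_maxM x y^-1%R) _.
  by rewrite (leq_trans _ (leq_pmull _ (isT : 0 < 2)%N)) // leq_mul2l rat_maxV orbT.
- by rewrite /rat_bits addn_gt0.
- have [nx dx] := absz_rat_max x.
  have bP m : (m <= rat_max x -> bits m <= rat_height x)%N.
    move=> hm; rewrite /bits /rat_height ltnS.
    apply: leq_trans (leq_trunc_log 2 hm) _.
    have := up_logP (rat_max x) (isT : (1 < 2)%N).
    have := trunc_logP (isT : (1 < 2)%N) (rat_max_gt0 x).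
    move=> /leq_trans h/h; by rewrite leq_exp2l.
  by rewrite /rat_bits; have := bP _ nx; have := bP _ dx; lia.
- have tP m : (m <= 2 ^ bits m)%N by rewrite ltnW // trunc_log_ltn.
  apply: (@leq_trans (rat_bits x).+1); last first.
    by rewrite /rat_bits /bits; lia.
  rewrite /rat_height ltnS; apply: up_log_min => //.
  rewrite geq_max; apply/andP; split; apply: leq_trans (tP _) _;
    by rewrite leq_exp2l // /rat_bits ?leq_addr ?leq_addl.
Qed.

(** * Structured programs *)

Inductive bexp :=
  | BTest of test
  | BNot of bexp
  | BAnd of bexp & bexp
  | BOr of bexp & bexp.

(** Short-circuit evaluation that duplicates branches. The code may grow exponentially with the
    test, but tests are fixed once [k] is, and a run pays only for the tests it meets. *)
Fixpoint cif (b : bexp) (c1 c2 : cmd) : cmd :=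
  match b with
  | BTest t => If t c1 c2
  | BNot b => cif b c2 c1
  | BAnd b b' => cif b (cif b' c1 c2) c2
  | BOr b b' => cif b c1 (cif b' c1 c2)
  end.

(* [eN], [eM], [eQ] evaluate to the numbers of segments, municipalities and
   OD pairs. The scratch memory is addressed relative to the end of the input:
   [eIB] and [eRB] are the first addresses beyond it (for [Linear], [eRB]
   leaves the unused place of the thresholds free). *)
Definition eN := ISub (IGet (IConst 0)) (IConst 1).
Definition eM := IGet (IConst 1).
Definition eQ := IGet (IConst 2).
Definition eIB := IAdd (IConst 3) (IAdd eN (IAdd eQ eQ)).
Definition eRB := IAdd (IAdd eN eN) (IAdd eM (IAdd eQ eQ)).

Definition avar (j : nat) : iexp := IAdd eIB (IConst j).
Definition var (j : nat) : iexp := IGet (avar j).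
Definition rloc (a : iexp) : rexp := RGet (IAdd eRB a).

(** Assignments are relative to the end of the input, so a program cannot overwrite its input; loops
    only count up to a limit. *)
Inductive prog :=
  | PSkip
  | PI of nat & iexp
  | PR of iexp & rexp
  | PSeq of prog & prog
  | PIf of bexp & prog & prog
  | PFor of nat & iexp & prog.

Definition for_test (j : nat) (e : iexp) : test :=
  ILe (IAdd (var j) (IConst 1)) e.

Definition incr (j : nat) : cmd := ISet (avar j) (IAdd (var j) (IConst 1)).

Fixpoint compile (p : prog) : cmd :=
  match p with
  | PSkip => Skip
  | PI j e => ISet (avar j) e
  | PR a e => RSet (IAdd eRB a) e
  | PSeq p1 p2 => Seq (compile p1) (compile p2)
  | PIf b p1 p2 => cif b (compile p1) (compile p2)
  | PFor j e p => Seq (ISet (avar j) (IConst 0))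
                      (While (for_test j e) (Seq (compile p) (incr j)))
  end.

(* Number of leaves: bounds the height of a value in terms of the heights of
   the memory cells read. *)
Fixpoint rwidth (e : rexp) : nat :=
  match e with
  | RZero | ROne | RGet _ => 1
  | RAdd e1 e2 | RSub e1 e2 | RMul e1 e2 | RDiv e1 e2 =>
      rwidth e1 + rwidth e2
  end.

Fixpoint rcoef (e : rexp) : nat :=
  2 * rwidth e +
  match e with
  | RZero | ROne => 1
  | RGet a => (icost a).+1
  | RAdd e1 e2 | RSub e1 e2 | RMul e1 e2 | RDiv e1 e2 =>
      (rcoef e1 + rcoef e2).+1
  end.

Definition tcoef (t : test) : nat :=
  match t with
  | ILe e1 e2 => (icost e1 + icost e2).+1
  | RLe e1 e2 => (rcoef e1 + rcoef e2).+1
  end.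

Fixpoint bcoef (b : bexp) : nat :=
  match b with
  | BTest t => (tcoef t).+1
  | BNot b => bcoef b
  | BAnd b b' | BOr b b' => bcoef b + bcoef b'
  end.

(* Cost of [compile p] when all memory cells have height at most [B] and all loops
   at most [L] iterations. *)
Fixpoint pcost (B L : nat) (p : prog) : nat :=
  match p with
  | PSkip => 1
  | PI j e => (icost (avar j) + icost e).+1
  | PR a e => (icost (IAdd eRB a) + rcoef e).+1 * B
  | PSeq p1 p2 => (pcost B L p1 + pcost B L p2).+1
  | PIf b p1 p2 => bcoef b * B + (pcost B L p1 + pcost B L p2)
  | PFor j e p =>
      icost (avar j) + 3 +
      L.+1 * (tcoef (for_test j e) + pcost B L p + icost (avar j)
              + icost (IAdd (var j) (IConst 1)) + 4)
  end.

(** Bounds by a power of [B * L.+1] are closed under sums, and each loop level costs one more factor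
    [L.+1]; so coefficient and exponent depend on the program alone. *)
Lemma pcost_poly (p : prog) :
  exists a b, forall B L, 0 < B -> pcost B L p <= a * (B * L.+1) ^ b.
Proof.
have base a : forall B L, 0 < B -> a * B <= a * (B * L.+1) ^ 1.
  by move=> B L hB; rewrite expn1; nia.
have expB (B L b b' : nat) : 0 < B -> b <= b' ->
    (B * L.+1) ^ b <= (B * L.+1) ^ b'.
  by move=> hB hb; rewrite leq_pexp2l // muln_gt0 hB.
have addP (f g : nat -> nat -> nat) :
    (exists a b, forall B L, 0 < B -> f B L <= a * (B * L.+1) ^ b) ->
    (exists a b, forall B L, 0 < B -> g B L <= a * (B * L.+1) ^ b) ->
    exists a b, forall B L, 0 < B -> f B L + g B L <= a * (B * L.+1) ^ b.
  move=> [a [b hf]] [a' [b' hg]]; exists (a + a'), (maxn b b') => B L hB.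
  rewrite mulnDl leq_add //.
    by apply: leq_trans (hf _ _ hB) _; rewrite leq_mul // expB // leq_maxl.
  by apply: leq_trans (hg _ _ hB) _; rewrite leq_mul // expB // leq_maxr.
have cst c : exists a b, forall B L, 0 < B -> c <= a * (B * L.+1) ^ b.
  by exists c, 0 => B L _; rewrite expn0 muln1.
elim: p => [|j e|a e|p1 IH1 p2 IH2|b p1 IH1 p2 IH2|j e p IH]; rewrite /pcost
  -/pcost.
- exact: (cst 1).
- exact: cst.
- by exists (icost (IAdd eRB a) + rcoef e).+1, 1; apply: base.
- have [a [b hab]] := addP _ _ (addP _ _ IH1 IH2) (cst 1).
  by exists a, b => B L hB; rewrite -addn1 hab.
- apply: (addP (fun B _ => bcoef b * B)); last exact: addP IH1 IH2.
  by exists (bcoef b), 1; apply: base.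
- apply: (addP (fun _ _ => icost (avar j) + 3)); first exact: cst.
  set c1 := tcoef _; set c2 := icost (avar j); set c3 := icost _.
  have [a [b hab]] := addP _ _ IH (cst (c1 + c2 + c3 + 4)).
  (* The additional exponent absorbs the factor [L.+1], since [L.+1 <= B * L.+1]. *)
  exists a, b.+1 => B L hB.
  have -> : c1 + pcost B L p + c2 + c3 + 4
    = pcost B L p + (c1 + c2 + c3 + 4) by lia.
  apply: leq_trans (leq_mul (leqnn _) (hab _ _ hB)) _.
  rewrite expnS [leqRHS]mulnCA leq_mul2r; apply/orP; right; nia.
Qed.

(** * A total-correctness logic with cost and height bounds *)

Section Memory.
Variables (K : realFieldType) (sz h : K -> nat).
Hypothesis hh : height sz h.
Variables (n M q : nat) (inI : nat -> nat) (inR : nat -> K).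
Hypotheses (inI0 : inI 0 = n.+1) (inI1 : inI 1 = M) (inI2 : inI 2 = q).

Definition ibase := 3 + (n + (q + q)).
Definition rbase := (n + n) + (M + (q + q)).

(** The memory is split at the end of the input, and the scratch parts [V] and [W] are renumbered
    from 0; no aliasing with the input has to be considered afterwards. *)
Definition mk (V : nat -> nat) (W : nat -> K) : state K :=
  State (fun a => if a < ibase then inI a else V (a - ibase))
        (fun a => if a < rbase then inR a else W (a - rbase)).

Lemma ieval_eN V W : ieval (mk V W) eN = n.
Proof. by rewrite /= inI0 subn1. Qed.

Lemma ieval_eM V W : ieval (mk V W) eM = M.
Proof. by rewrite /= inI1. Qed.

Lemma ieval_eQ V W : ieval (mk V W) eQ = q.
Proof. by rewrite /= inI2. Qed.

Lemma ieval_eIB V W : ieval (mk V W) eIB = ibase.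
Proof. by rewrite /= inI0 inI2 subn1. Qed.

Lemma ieval_eRB V W : ieval (mk V W) eRB = rbase.
Proof. by rewrite /= inI0 inI1 inI2 subn1. Qed.

Lemma ieval_avar V W j : ieval (mk V W) (avar j) = ibase + j.
Proof. by rewrite -(ieval_eIB V W). Qed.

Lemma ieval_var V W j : ieval (mk V W) (var j) = V j.
Proof.
have -> : ieval (mk V W) (var j) = imem (mk V W) (ieval (mk V W) (avar j)) by [].
by rewrite ieval_avar /= ltnNge leq_addr addKn.
Qed.

Lemma ieval_add V W e1 e2 :
  ieval (mk V W) (IAdd e1 e2) = ieval (mk V W) e1 + ieval (mk V W) e2.
Proof. by []. Qed.

Lemma ieval_sub V W e1 e2 :
  ieval (mk V W) (ISub e1 e2) = ieval (mk V W) e1 - ieval (mk V W) e2.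
Proof. by []. Qed.

Lemma ieval_const V W c : ieval (mk V W) (IConst c) = c.
Proof. by []. Qed.

Lemma ieval_in V W e :
  ieval (mk V W) e < ibase -> ieval (mk V W) (IGet e) = inI (ieval (mk V W) e).
Proof. by move=> he; rewrite /= he. Qed.

Lemma reval_loc V W a : reval (mk V W) (rloc a) = W (ieval (mk V W) a).
Proof.
have -> : reval (mk V W) (rloc a)
  = rmem (mk V W) (ieval (mk V W) eRB + ieval (mk V W) a) by [].
by rewrite ieval_eRB /= ltnNge leq_addr addKn.
Qed.

Lemma reval_in V W a : ieval (mk V W) a < rbase ->
  reval (mk V W) (RGet a) = inR (ieval (mk V W) a).
Proof. by move=> ha; rewrite /= ha. Qed.

Lemma mk_iset V W j x :
  State (update (imem (mk V W)) (ibase + j) x) (rmem (mk V W))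
  = mk (update V j x) W.
Proof.
congr State; apply: functional_extensionality => a; rewrite /update /=.
by case: ltnP => ha; do 2?case: eqP; lia.
Qed.

Lemma mk_rset V W j x :
  State (imem (mk V W)) (update (rmem (mk V W)) (rbase + j) x)
  = mk V (update W j x).
Proof.
congr State; apply: functional_extensionality => a; rewrite /update /=.
case: ltnP => ha; do 2?case: eqP => //; lia.
Qed.

Variables B L : nat.
Hypotheses (B0 : 0 < B) (hin : forall a, h (inR a) <= B).

Definition bnd (W : nat -> K) := forall a, h (W a) <= B.

Lemma bnd_update W a x : bnd W -> h x <= B -> bnd (update W a x).
Proof. by move=> hW hx b; rewrite /update; case: eqP. Qed.

Lemma rmem_bnd V W a : bnd W -> h (rmem (mk V W) a) <= B.
Proof. by move=> hW; rewrite /=; case: ifP. Qed.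

Lemma reval_height V W e : bnd W -> h (reval (mk V W) e) <= rwidth e * B.
Proof.
move=> hW.
have op x y (w1 w2 : nat) : h x <= w1 * B -> h y <= w2 * B ->
  h x + h y <= (w1 + w2) * B by rewrite mulnDl; apply: leq_add.
elim: e => [||a|e1 IH1 e2 IH2|e1 IH1 e2 IH2|e1 IH1 e2 IH2|e1 IH1 e2 IH2].
- by apply: leq_trans (height0 hh) _; rewrite mul1n.
- by apply: leq_trans (height1 hh) _; rewrite mul1n.
- by rewrite mul1n; apply: rmem_bnd.
- exact: leq_trans (heightD hh _ _) (op _ _ _ _ IH1 IH2).
- exact: leq_trans (heightB hh _ _) (op _ _ _ _ IH1 IH2).
- exact: leq_trans (heightM hh _ _) (op _ _ _ _ IH1 IH2).
- exact: leq_trans (height_div hh _ _) (op _ _ _ _ IH1 IH2).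
Qed.

Lemma rcost_le V W e : bnd W -> rcost sz (mk V W) e <= rcoef e * B.
Proof.
move=> hW.
have szP e' : sz (reval (mk V W) e') <= 2 * rwidth e' * B.
  by apply: leq_trans (size_le_height hh _) _; rewrite -mulnA leq_mul2l
    reval_height.
elim: e => [||a|e1 IH1 e2 IH2|e1 IH1 e2 IH2|e1 IH1 e2 IH2|e1 IH1 e2 IH2];
  rewrite /rcost -/rcost /rcoef -/rcoef mulnDl; apply: leq_add (szP _) _;
  first [by rewrite leq_pmulr | by rewrite mulSn mulnDl -add1n leq_add // leq_add].
Qed.

Lemma tcost_le V W t : bnd W -> tcost sz (mk V W) t <= tcoef t * B.
Proof.
case: t => e1 e2 hW; first by rewrite leq_pmulr.
by rewrite /tcost /tcoef; have := rcost_le V e1 hW; have := rcost_le V e2 hW; nia.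
Qed.

Fixpoint beval (s : state K) (b : bexp) : bool :=
  match b with
  | BTest t => teval s t
  | BNot b => ~~ beval s b
  | BAnd b b' => beval s b && beval s b'
  | BOr b b' => beval s b || beval s b'
  end.

Lemma cif_exec b c1 c2 V W t s' : bnd W ->
  exec sz (if beval (mk V W) b then c1 else c2) (mk V W) t s' ->
  exists2 t', exec sz (cif b c1 c2) (mk V W) t' s' & t' <= bcoef b * B + t.
Proof.
move=> hW; elim: b c1 c2 t => [u|b IH|b IH b' IH'|b IH b' IH'] c1 c2 t /=.
- move=> ht; exists (tcost sz (mk V W) u + t).+1; first exact: ExecIf.
  by rewrite -addSn leq_add2r mulSn -add1n leq_add // tcost_le.
- by rewrite if_neg; apply: IH.
- case: ifP => [/andP[hb hb'] ht|hbb ht].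
    have [t1 e1 l1] := IH' c1 c2 t ltac:(by rewrite hb').
    have [t2 e2 l2] := IH (cif b' c1 c2) c2 t1 ltac:(by rewrite hb).
    by exists t2 => //; lia.
  case hb: (beval (mk V W) b) hbb => /= hb'.
    have [t1 e1 l1] := IH' c1 c2 t ltac:(by rewrite hb').
    have [t2 e2 l2] := IH (cif b' c1 c2) c2 t1 ltac:(by rewrite hb).
    by exists t2 => //; lia.
  have [t2 e2 l2] := IH (cif b' c1 c2) c2 t ltac:(by rewrite hb).
  by exists t2 => //; lia.
- case hb: (beval (mk V W) b) => /= ht.
    have [t2 e2 l2] := IH c1 (cif b' c1 c2) t ltac:(by rewrite hb).
    by exists t2 => //; lia.
  have [t1 e1 l1] := IH' c1 c2 t ht.
  have [t2 e2 l2] := IH c1 (cif b' c1 c2) t1 ltac:(by rewrite hb).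
  by exists t2 => //; lia.
Qed.

(** A weakest precondition for total correctness. The height bound is assumed and re-established
    because the cost of operations on [K] is controlled only through it. *)
Definition runs (p : prog) V W (Q : (nat -> nat) -> (nat -> K) -> Prop) :=
  bnd W -> exists t V' W',
    [/\ exec sz (compile p) (mk V W) t (mk V' W'), t <= pcost B L p,
        bnd W' & Q V' W'].

Lemma runs_conseq p V W (Q Q' : (nat -> nat) -> (nat -> K) -> Prop) :
  runs p V W Q -> (forall V' W', bnd W' -> Q V' W' -> Q' V' W') ->
  runs p V W Q'.
Proof.
move=> hp hQ /hp[t [V' [W' [ht lt bW hq]]]].
by exists t, V', W'; split=> //; apply: hQ.
Qed.

Lemma runs_skip V W (Q : (nat -> nat) -> (nat -> K) -> Prop) :
  Q V W -> runs PSkip V W Q.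
Proof. by move=> hQ hW; exists 1, V, W; split=> //; apply: ExecSkip. Qed.

Lemma runs_iset V W j e (Q : (nat -> nat) -> (nat -> K) -> Prop) :
  Q (update V j (ieval (mk V W) e)) W -> runs (PI j e) V W Q.
Proof.
move=> hQ hW; do 3!eexists; split; last exact: hQ; last exact: hW.
  by rewrite -mk_iset -(ieval_avar V W); apply: ExecISet.
exact: leqnn.
Qed.

Lemma runs_rset V W a e (Q : (nat -> nat) -> (nat -> K) -> Prop) :
  h (reval (mk V W) e) <= B ->
  Q V (update W (ieval (mk V W) a) (reval (mk V W) e)) -> runs (PR a e) V W Q.
Proof.
move=> he hQ hW; do 3!eexists; split; last exact: hQ.
- by rewrite -mk_rset -(ieval_eRB V W); apply: ExecRSet.
- by rewrite /pcost; have := rcost_le V e hW; nia.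
- exact: bnd_update.
Qed.

Lemma runs_seq V W p1 p2 (Q : (nat -> nat) -> (nat -> K) -> Prop) :
  runs p1 V W (fun V' W' => runs p2 V' W' Q) -> runs (PSeq p1 p2) V W Q.
Proof.
move=> h1 /h1[t1 [V1 [W1 [e1 l1 b1 /(_ b1)]]]] [t2 [V2 [W2 [e2 l2 b2 hQ]]]].
exists (t1 + t2).+1, V2, W2; split=> //; first exact: ExecSeq e1 e2.
by rewrite ltnS leq_add.
Qed.

Lemma runs_if V W b p1 p2 (Q : (nat -> nat) -> (nat -> K) -> Prop) :
  runs (if beval (mk V W) b then p1 else p2) V W Q -> runs (PIf b p1 p2) V W Q.
Proof.
move=> h1 hW; have [t [V' [W' [e1 l1 b1 hQ]]]] := h1 hW.
have [|t' e' l'] := @cif_exec b (compile p1) (compile p2) V W t (mk V' W') hW.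
  by move: e1; case: ifP.
exists t', V', W'; split=> //; apply: leq_trans l' _.
by rewrite /= leq_add2l; apply: leq_trans l1 _; case: ifP; rewrite ?leq_addr
  ?leq_addl.
Qed.

(** [Inv i] describes the memory at the loop test, with the counter already set to [i]; hence the
    updates in the premises. The limit is evaluated anew at each test, so the invariant has to
    determine its value. *)
Lemma runs_for V W j e p m (Inv : nat -> (nat -> nat) -> (nat -> K) -> Prop)
    (Q : (nat -> nat) -> (nat -> K) -> Prop) :
  m <= L ->
  (forall i V' W', Inv i V' W' -> ieval (mk V' W') e = m) ->
  Inv 0 (update V j 0) W ->
  (forall i V' W', i < m -> bnd W' -> V' j = i -> Inv i V' W' ->
    runs p V' W' (fun V'' W'' =>
      V'' j = i /\ Inv i.+1 (update V'' j i.+1) W'')) ->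
  (forall V' W', bnd W' -> V' j = m -> Inv m V' W' -> Q V' W') ->
  runs (PFor j e p) V W Q.
Proof.
move=> mL hm h0 hS hQ hW.
set D := tcoef (for_test j e) + pcost B L p + icost (avar j)
              + icost (IAdd (var j) (IConst 1)) + 4.
have testP V' W' : teval (mk V' W') (for_test j e) = (V' j < ieval (mk V' W') e).
  by rewrite /for_test /teval ieval_add ieval_var ieval_const addn1.
have tcP V' W' : tcost sz (mk V' W') (for_test j e) = tcoef (for_test j e) by [].
(* Induction on the number [r] of iterations left; [r.+1] includes the final failing test. *)
have loop r i V' W' : r + i = m -> bnd W' -> V' j = i -> Inv i V' W' ->
  exists t V'' W'',
   [/\ exec sz (While (for_test j e) (Seq (compile p) (incr j))) (mk V' W') t
     (mk V'' W''),
      t <= r.+1 * D, bnd W'' & Q V'' W''].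
  elim: r i V' W' => [|r IH] i V' W' ri bW Vi hI.
    exists (tcoef (for_test j e)).+1, V', W'; split=> //.
    - rewrite -(tcP V' W'); apply: ExecWhileEnd.
      by rewrite testP (hm _ _ _ hI) Vi -ri add0n ltnn.
    - by rewrite /D; lia.
    - by apply: hQ => //; rewrite -ri // Vi.
  have im : i < m by lia.
  have [t1 [V1 [W1 [e1 l1 b1 [V1i hI1]]]]] := hS i V' W' im bW Vi hI bW.
  have ri1 : r + i.+1 = m by lia.
  have Vj1 : update V1 j i.+1 j = i.+1 by rewrite /update eqxx.
  have [t2 [V2 [W2 [e2 l2 b2 hQ2]]]] := IH i.+1 _ _ ri1 b1 Vj1 hI1.
  exists (tcost sz (mk V' W') (for_test j e)
     + (t1 + (icost (avar j) + icost (IAdd (var j) (IConst 1))).+1).+1 +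
       t2).+1, V2, W2.
  split=> //.
  - apply: ExecWhileStep e2; first by rewrite testP (hm _ _ _ hI) Vi.
    apply: ExecSeq e1 _.
    have -> : mk (update V1 j i.+1) W1 =
       State (update (imem (mk V1 W1)) (ieval (mk V1 W1) (avar j))
                (ieval (mk V1 W1) (IAdd (var j) (IConst 1)))) (rmem (mk V1 W1)).
      by rewrite ieval_avar mk_iset ieval_add ieval_var ieval_const V1i addn1.
    exact: ExecISet.
  - by rewrite tcP mulSn /D; move: l1 l2; rewrite /D; nia.
have Vj0 : update V j 0 j = 0 by rewrite /update eqxx.
have [t [V' [W' [e1 l1 b1 hQ']]]] := loop _ _ _ _ (addn0 m) hW Vj0 h0.
exists ((icost (avar j) + icost (IConst 0)).+1 + t).+1, V', W'; split=> //.
- apply: ExecSeq e1.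
  by rewrite -mk_iset -(ieval_avar V W); apply: (ExecISet _ _ _ (IConst 0)).
- rewrite /pcost -/pcost -/D; move: l1 => /=.
  have : m.+1 * D <= L.+1 * D by rewrite leq_mul2r ltnS mL orbT.
  by lia.
Qed.

End Memory.

(** * Components as runs of consecutive segments *)

Section Runs.
Variable n : nat.
Implicit Types (e f : 'I_n) (F : {set 'I_n}).

Definition run_starts F : {set 'I_n} :=
  [set e in F | [forall f in F, f.+1 != e :> nat]].

Definition left_end e : 'I_n.+1 := widen_ord (leqnSn n) e.

Lemma adj_sym F : symmetric (adj F).
Proof.
by move=> x y; apply: eq_existsb => e; rewrite /joins orbC.
Qed.

Lemma connect_adj_sym F : connect_sym (adj F).
Proof. exact/sym_connect_sym/adj_sym. Qed.

Lemma adj_left_end F f (x : 'I_n.+1) : f \in F ->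
  (x = f :> nat \/ x = f.+1 :> nat) -> connect (adj F) (left_end f) x.
Proof.
move=> fF [xf|xf].
  by rewrite (_ : x = left_end f) ?connect0 //; apply: val_inj.
by apply/connect1/existsP; exists f; rewrite fF /joins xf !eqxx.
Qed.

(** Walk left until the preceding segment is missing. The connection serves to count components, the
    filled range to recover [F] from intervals. *)
Lemma run_start_below F f : f \in F ->
  exists e, [/\ e \in run_starts F, e <= f,
    forall y : 'I_n, e <= y <= f -> y \in F
    & connect (adj F) (left_end e) (left_end f)].
Proof.
move: {2}(val f) (erefl (val f)) => m; elim: m f => [|m IH] f fm fF.
  exists f; split=> //; last 1 first.
  - by move=> y; rewrite -eqn_leq => /eqP/val_inj <-.
  - rewrite inE fF; apply/forall_inP => f' _; by rewrite -[val f]/(nat_of_ord f) fm.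
have [fs|] := boolP (f \in run_starts F).
  by exists f; split=> // y; rewrite -eqn_leq => /eqP/val_inj <-.
rewrite inE fF /= negb_forall_in => /exists_inP[g gF]; rewrite negbK => /eqP gf.
have [|e [es eg he ce]] := IH g _ gF; first by move: gf fm => /=; lia.
exists e; split=> //; first by rewrite -gf; exact: leqW.
  move=> y /andP[ey yf]; have [yg|gy] := leqP y g; first by apply: he; rewrite ey.
  by rewrite (_ : y = f) //; apply: val_inj => /=; lia.
apply: connect_trans ce _; apply: adj_left_end => //.
by right; rewrite /= -gf.
Qed.

(** Each component is represented by the left end of its first segment: the map to component roots
    is onto because every segment is connected to the start of its run, and injective because no
    edge of [F] enters a run start from the left. *)
Lemma componentsE F : components F = #|run_starts F|.
Proof.
rewrite /components /n_comp_mem.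
rewrite -(card_in_imset (f := fun e => fingraph.root (adj F) (left_end e)));
  last first.
  suff lt e f : e < f -> f \in run_starts F ->
      fingraph.root (adj F) (left_end e) <> fingraph.root (adj F) (left_end f).
    move=> e f es fs /= ef; apply: val_inj; case: (ltngtP e f) => // /lt hlt.
      by case: (hlt fs).
    by case: (hlt es).
  move=> ef; rewrite inE => /andP[fF /forall_inP hf] /eqP.
  rewrite root_connect; last exact: connect_adj_sym.
  (* An edge leaving the stations below [f] would be the segment just before [f], which is absent
     because [f] is a run start. *)
  have cl : closed (adj F) [pred x : 'I_n.+1 | x < f].
    move=> x y /existsP[g /andP[/hf gf]]; rewrite !inE.
    by case/orP => /andP[/eqP -> /eqP ->]; move/eqP: gf; lia.
  by move/(closed_connect cl); rewrite !inE /= ef ltnn.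
apply: eq_card => x; rewrite !inE; apply/andP/imsetP.
  move=> [/eqP rx /existsP[y /existsP[f /andP[fF fxy]]]].
  have [e [es _ _ ce]] := run_start_below fF; exists e => //.
  rewrite -rx; apply/eqP; rewrite eq_sym root_connect; last exact: connect_adj_sym.
  apply: connect_trans ce _; apply: adj_left_end => //.
  by case/orP: fxy => /andP[/eqP h1 /eqP h2]; [left|right].
move=> [e]; rewrite inE => /andP[eF _] ->.
split; first exact/roots_root/connect_adj_sym.
have cl : closed (adj F) (incident F).
  apply: intro_closed; first exact: connect_adj_sym.
  by move=> y z yz _; rewrite inE; apply/existsP; exists y; rewrite adj_sym.
have := closed_connect cl (connect_root (adj F) (left_end e)).
rewrite !inE => <-.
apply/existsP; exists (lift ord0 e); apply/existsP; exists e.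
by rewrite eF /joins /= /bump !eqxx.
Qed.

(* [X (2 i)] and [X (2 i + 1)] are the end stations of the [i]-th interval. *)
Definition covered (k : nat) (X : nat -> nat) (e : nat) : bool :=
  has (fun i => X (i + i) <= e < X (i + i).+1) (iota 0 k).

Definition interval_set (k : nat) (X : nat -> nat) : {set 'I_n} :=
  [set e : 'I_n | covered k X e].

Lemma coveredP k X (e : nat) :
  reflect (exists2 i, i < k & X (i + i) <= e < X (i + i).+1) (covered k X e).
Proof.
by apply: (iffP hasP) => -[i]; [rewrite mem_iota|]; exists i => //; rewrite
  mem_iota.
Qed.

(** Intervals may be empty, overlap or touch, so there is only an inequality: every run of the union
    begins where one of the intervals begins. *)
Lemma components_interval_set k X : components (interval_set k X) <= k.
Proof.
rewrite componentsE -[leqRHS]card_ord.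
pose g (i : 'I_k) := [pick e : 'I_n | e == X (i + i) :> nat].
have sub : [set Some e | e in run_starts (interval_set k X)] \subset g @: 'I_k.
  apply/subsetP => x /imsetP[e]; rewrite inE inE => /andP[/coveredP[i ik hi]
    /forall_inP he] xe; rewrite {}xe.
  (* Otherwise the interval covering [e] would cover [e.-1] too. *)
  have eX : X (i + i) = e.
    have [//|ne] := eqVneq (X (i + i)) e.
    have e0 : e.-1 < n by have := ltn_ord e; lia.
    have := he (Ordinal e0); rewrite inE /=.
    have -> : covered k X e.-1 by apply/coveredP; exists i => //=; lia.
    by move=> /(_ isT); lia.
  apply/imsetP; exists (Ordinal ik) => //; rewrite /g /=.
  case: pickP => [e' /eqP e'X|/(_ e)]; last by rewrite eX eqxx.
  by congr Some; apply: val_inj; rewrite /= e'X eX.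
rewrite -(card_imset _ (@Some_inj _)); apply: leq_trans (subset_leq_card sub) _.
exact: leq_imset_card.
Qed.

(** If no segment is missing from [e] on, [find] returns the length [n], which is the last station
    and hence the correct end. *)
Definition run_end F (e : nat) : nat :=
  find (fun y => (e <= y) && ~~ [exists f in F, f == y :> nat]) (iota 0 n).

Lemma run_end_in F (e : nat) (y : 'I_n) : e <= y < run_end F e -> y \in F.
Proof.
move=> /andP[ey yr]; have := before_find 0 yr.
rewrite nth_iota // add0n ey /= => /negbFE /exists_inP[f fF /eqP fy].
by rewrite -(val_inj fy).
Qed.

Lemma lt_run_end F (e : nat) (f : 'I_n) : e <= f ->
  (forall y : 'I_n, e <= y <= f -> y \in F) -> f < run_end F e.
Proof.
move=> ef hF; rewrite ltnNge; apply/negP => rf.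
have rn : run_end F e < n by apply: leq_ltn_trans rf (ltn_ord f).
have := nth_find 0 (a := fun y => (e <= y) && ~~ [exists f in F, f == y :>
  nat]) (s := iota 0 n).
rewrite has_find size_iota => /(_ rn); rewrite -/(run_end F e) nth_iota // add0n.
case/andP=> er /exists_inP[]; exists (Ordinal rn) => //=.
by apply: hF; rewrite er.
Qed.

Lemma interval_set_surj k F : components F <= k ->
  exists2 X, (forall j, X j <= n) & interval_set k X = F.
Proof.
rewrite componentsE => hk.
pose s := [seq val e | e <- enum (run_starts F)].
have ss : size s = #|run_starts F| by rewrite size_map -cardE.
(* One interval per run; the intervals left over are [[0, 0)], thus empty. *)
pose X j := if j./2 < size s then
  if odd j then run_end F (nth 0 s j./2) else nth 0 s j./2 else 0.
have sP i : i < size s -> exists2 e : 'I_n, e \in run_starts F & nth 0 s i = e.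
  move=> /(mem_nth 0)/mapP[e]; rewrite mem_enum => es ->; by exists e.
have X0 i : X (i + i) = if i < size s then nth 0 s i else 0.
  by rewrite /X addnn odd_double doubleK.
have X1 i : X (i + i).+1 = if i < size s then run_end F (nth 0 s i) else 0.
  by rewrite /X addnn -[_.*2.+1]/(true + i.*2) oddD odd_double half_bit_double.
exists X.
  move=> j; rewrite /X; case: ifP => // js; case: odd.
    by rewrite -[leqRHS](size_iota 0) find_size.
  by have [e _ ->] := sP _ js; apply/ltnW/ltn_ord.
apply/setP => f; rewrite inE; apply/coveredP/idP => [[i ik]|fF].
  by rewrite X0 X1; case: ifP => _; [apply: run_end_in|rewrite ltn0 andbF].
have [e [es ef he _]] := run_start_below fF.
have es' : val e \in s by apply: map_f; rewrite mem_enum.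
exists (index (val e) s); first by apply: leq_trans hk; rewrite -ss index_mem.
by rewrite X0 X1 index_mem es' nth_index // ef lt_run_end.
Qed.

End Runs.

(** * The program *)

(* Index variables: 0 segment, 1 municipality or OD pair, 2 domination flag,
   3 number of candidates, 4 end of the output list, 5 and 6 candidates,
   10 + j the j-th coordinate of the current intervals. Real variables: 0 and 1
   partial sums, 2 budget, 3 passengers, then the list of points. *)

Definition sum_prog (g : bexp) (off : iexp) (acc : nat) : prog :=
  PSeq (PR (IConst acc) RZero)
    (PFor 0 eN
      (PIf g (PR (IConst acc)
                 (RAdd (rloc (IConst acc)) (RGet (IAdd off (var 0)))))
         PSkip)).

(** Unrolled into a single test because [k] is fixed; [1 <= 0] stands for falsity. *)
Fixpoint covered_test (k : nat) : bexp :=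
  match k with
  | 0 => BTest (ILe (IConst 1) (IConst 0))
  | k.+1 =>
      BOr (covered_test k)
        (BAnd (BTest (ILe (var (10 + (k + k))) (var 0)))
              (BTest (ILe (IAdd (var 0) (IConst 1)) (var (10 + (k + k).+1)))))
  end.

Definition mun_test : bexp :=
  let m := IGet (IAdd (IConst 3) (var 0)) in
  BAnd (BTest (ILe m (var 1))) (BTest (ILe (var 1) m)).

Definition route_test : bexp :=
  let x := IGet (IAdd (IConst 3) (IAdd eN (IAdd (var 1) (var 1)))) in
  let y := IGet (IAdd (IConst 4) (IAdd eN (IAdd (var 1) (var 1)))) in
  let e' := IAdd (var 0) (IConst 1) in
  BOr (BAnd (BTest (ILe x (var 0))) (BTest (ILe e' y)))
      (BAnd (BTest (ILe y (var 0))) (BTest (ILe e' x))).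

Definition budget_prog (k : nat) : prog :=
  let quot := RDiv (rloc (IConst 0)) (RGet (IAdd (IAdd eN eN) (var 1))) in
  PSeq (PR (IConst 2) RZero)
    (PFor 1 eM
      (PSeq (sum_prog (BAnd (covered_test k) mun_test) (IConst 0) 0)
        (PIf (BTest (RLe (rloc (IConst 2)) quot))
           (PR (IConst 2) quot) PSkip))).

Definition passengers_prog (resp : response) (k : nat) : prog :=
  let dem := RGet (IAdd (IAdd (IAdd eN eN) eM) (var 1)) in
  let thr := RGet (IAdd (IAdd (IAdd (IAdd eN eN) eM) eQ) (var 1)) in
  let add e := PR (IConst 3) (RAdd (rloc (IConst 3)) e) in
  PSeq (PR (IConst 3) RZero)
    (PFor 1 eQ
      (PSeq (sum_prog (BAnd (covered_test k) route_test) eN 0)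
        (match resp with
         | Linear =>
             PSeq (sum_prog route_test eN 1)
               (add (RMul dem (RDiv (rloc (IConst 0)) (rloc (IConst 1)))))
         | MinImprov =>
             PIf (BTest (RLe thr (rloc (IConst 0)))) (add dem) PSkip
         end))).

Definition point_addr (c i : nat) : iexp :=
  IAdd (IConst (4 + c)) (IAdd (var i) (var i)).

Definition push_prog (j : nat) (e1 e2 : rexp) : prog :=
  PSeq (PR (point_addr 0 j) e1)
    (PSeq (PR (point_addr 1 j) e2) (PI j (IAdd (var j) (IConst 1)))).

Definition candidate_prog (resp : response) (k : nat) : prog :=
  PSeq (budget_prog k)
    (PSeq (passengers_prog resp k)
       (push_prog 3 (rloc (IConst 3)) (rloc (IConst 2)))).

(** The limit is [n + 1] because interval ends range over all stations [0, ..., n]. *)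
Fixpoint nest (j : nat) (p : prog) : prog :=
  match j with
  | 0 => p
  | j.+1 => PFor (10 + j) (IAdd eN (IConst 1)) (nest j p)
  end.

Definition dominates_test (i j : nat) : bexp :=
  BAnd (BTest (RLe (rloc (point_addr 0 j)) (rloc (point_addr 0 i))))
       (BTest (RLe (rloc (point_addr 1 i)) (rloc (point_addr 1 j)))).

(** Survivors are appended behind the candidate list, which stays intact for the remaining
    comparisons. *)
Definition filter_prog : prog :=
  PSeq (PI 4 (var 3))
    (PFor 5 (var 3)
      (PSeq (PI 2 (IConst 0))
        (PSeq
          (PFor 6 (var 3)
            (PIf (BAnd (dominates_test 6 5)
                       (BOr (BNot (dominates_test 5 6))
                            (BTest (ILe (IAdd (var 6) (IConst 1)) (var 5)))))
               (PI 2 (IConst 1)) PSkip))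
          (PIf (BTest (ILe (var 2) (IConst 0)))
             (push_prog 4 (rloc (point_addr 0 5)) (rloc (point_addr 1 5)))
             PSkip)))).

Definition main_prog (resp : response) (k : nat) : prog :=
  PSeq (nest (k + k) (candidate_prog resp k)) filter_prog.

(** Not a [prog], since it overwrites input cells. The order matters: [eRB] reads cells 0, 1 and 2,
    whereas [var] reads only 0 and 2, so cell 1 has to be written first. *)
Definition announce : cmd :=
  Seq (ISet (IConst 1) (IAdd eRB (point_addr 0 3)))
      (ISet (IConst 0) (ISub (var 4) (var 3))).

Definition solver (resp : response) (k : nat) : cmd :=
  Seq (compile (main_prog resp k)) announce.

(** The start value 0 encodes the constraint [0 <= v] of feasibility. *)
Fixpoint max_upto (K : realFieldType) (g : nat -> K) (m : nat) : K :=
  if m is m.+1 then Num.max (max_upto g m) (g m) else 0%R.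

Definition dominates (K : realFieldType) (y z : K * K) : bool :=
  (z.1 <= y.1)%R && (y.2 <= z.2)%R.

(** Many choices of intervals yield equal points; the tie-break [j < i] keeps exactly the first
    copy. *)
Definition dropped (K : realFieldType) (L : seq (K * K)) (i j : nat) : bool :=
  let z := nth (0%R, 0%R) L in
  dominates (z j) (z i) && (~~ dominates (z i) (z j) || (j < i)).

Definition pareto (K : realFieldType) (L : seq (K * K)) : seq (K * K) :=
  [seq nth (0%R, 0%R) L i | i <- iota 0 (size L)
                          & ~~ has (dropped L i) (iota 0 (size L))].

(** * Correctness of the program and heights of its values *)

Section Correctness.
Variables (K : realFieldType) (sz h : K -> nat).
Hypothesis hh : height sz h.
Variables (resp : response) (k n M q : nat) (inI : nat -> nat) (inR : nat -> K).
Hypotheses (inI0 : inI 0 = n.+1) (inI1 : inI 1 = M) (inI2 : inI 2 = q).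

Local Notation mk := (mk n M q inI inR).
Local Notation rbase := (rbase n M q).
Local Notation ibase := (ibase n q).

Variables A L : nat.
Hypotheses (A0 : 0 < A) (hin : forall a, h (inR a) <= A).
Hypotheses (nL : n < L) (ML : M <= L) (qL : q <= L).

Definition sum_bound := 1 + n * A.
(** The middle term covers [q] OD contributions, each a demand times a quotient of two sums over
    segments; the last one covers a cost sum divided by a share. The leading 1 is the height of the
    initial 0. *)
Definition value_bound := 1 + q * (A + (sum_bound + sum_bound)) + (sum_bound + A).

Lemma value_bound_gt0 : 0 < value_bound. Proof. by []. Qed.

Lemma input_le_value_bound : A <= value_bound. Proof. by rewrite /value_bound
  addnA leq_addl. Qed.

Lemma inR_height a : h (inR a) <= value_bound.
Proof. exact: leq_trans (hin a) input_le_value_bound. Qed.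

Local Notation runs := (runs sz h n M q inI inR value_bound L).

Lemma ieval_N V W : ieval (mk V W) eN = n. Proof. exact: ieval_eN. Qed.
Lemma ieval_M V W : ieval (mk V W) eM = M. Proof. exact: ieval_eM. Qed.
Lemma ieval_Q V W : ieval (mk V W) eQ = q. Proof. exact: ieval_eQ. Qed.
Lemma ieval_V V W j : ieval (mk V W) (var j) = V j. Proof. exact: ieval_var. Qed.
Lemma reval_W V W a : reval (mk V W) (rloc a) = W (ieval (mk V W) a).
Proof. exact: reval_loc. Qed.

Lemma reval_add V W e1 e2 : reval (mk V W) (RAdd e1 e2)
  = (reval (mk V W) e1 + reval (mk V W) e2)%R.
Proof. by []. Qed.
Lemma reval_mul V W e1 e2 : reval (mk V W) (RMul e1 e2)
  = (reval (mk V W) e1 * reval (mk V W) e2)%R.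
Proof. by []. Qed.
Lemma reval_div V W e1 e2 : reval (mk V W) (RDiv e1 e2)
  = (reval (mk V W) e1 / reval (mk V W) e2)%R.
Proof. by []. Qed.

Lemma reval_zero V W : reval (mk V W) RZero = 0%R.
Proof. by []. Qed.
Lemma beval_rle V W e1 e2 : beval (mk V W) (BTest (RLe e1 e2))
  = (reval (mk V W) e1 <= reval (mk V W) e2)%R.
Proof. by []. Qed.
Lemma beval_ile V W e1 e2 : beval (mk V W) (BTest (ILe e1 e2))
  = (ieval (mk V W) e1 <= ieval (mk V W) e2).
Proof. by []. Qed.
Lemma beval_and V W b1 b2 : beval (mk V W) (BAnd b1 b2)
  = beval (mk V W) b1 && beval (mk V W) b2.
Proof. by []. Qed.
Lemma beval_or V W b1 b2 : beval (mk V W) (BOr b1 b2)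
  = beval (mk V W) b1 || beval (mk V W) b2.
Proof. by []. Qed.
Lemma beval_not V W b : beval (mk V W) (BNot b) = ~~ beval (mk V W) b.
Proof. by []. Qed.

Local Notation bE := (beval_rle, beval_ile, beval_and, beval_or, beval_not).
Local Notation iE := (ieval_add, ieval_sub, ieval_const, ieval_N, ieval_M,
  ieval_Q, ieval_V,
  reval_W, reval_zero, reval_add, reval_mul, reval_div).

Lemma sum_nat_recr (c : nat -> bool) (a : nat -> K) m :
  (\sum_(0 <= i < m.+1 | c i) a i
   = \sum_(0 <= i < m | c i) a i + (if c m then a m else 0))%R.
Proof. by rewrite big_mkcond big_nat_recr //= -big_mkcond. Qed.

Local Notation rset := (runs_rset hh inI0 inI1 inI2 L value_bound_gt0 inR_height).
Local Notation iset := (runs_iset sz inI0 inI1 inI2 L).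
Local Notation rif := (runs_if hh inI0 inI1 inI2 value_bound_gt0 inR_height).
Local Notation rfor := (runs_for inI0 inI1 inI2 value_bound_gt0).

Lemma height_sum (c : nat -> bool) (a : nat -> K) m A' :
  (forall i, h (a i) <= A') ->
  h (\sum_(0 <= i < m | c i) a i)%R <= 1 + m * A'.
Proof.
move=> ha; elim: m => [|m IH].
  by rewrite big_geq //; apply: leq_trans (height0 hh) _.
rewrite sum_nat_recr.
case: ifP => _; last by rewrite addr0; apply: leq_trans IH _; rewrite leq_add2l
  leq_mul.
apply: leq_trans (heightD hh _ _) _.
by rewrite mulSn [A' + _]addnC addnA leq_add.
Qed.

(** Guard and offset are evaluated inside the loop, hence the premises for all memories whose index
    variables agree with [V] except for the counter 0. *)
Lemma runs_sum g off (acc : nat) (V : nat -> nat) (W : nat -> K) (c : nat -> bool) o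
    (Q : (nat -> nat) -> (nat -> K) -> Prop) :
  o + n <= rbase ->
  (forall V' W', (forall j : nat, j != 0 -> V' j = V j) -> V' 0 < n ->
     beval (mk V' W') g = c (V' 0)) ->
  (forall V' W', (forall j : nat, j != 0 -> V' j = V j) ->
     ieval (mk V' W') off = o) ->
  (forall V' W', (forall j : nat, j != 0 -> V' j = V j) ->
     (forall a : nat, a != acc -> W' a = W a) ->
     W' acc = (\sum_(0 <= e < n | c e) inR (o + e))%R -> Q V' W') ->
  runs (sum_prog g off acc) V W Q.
Proof.
move=> on hg hoff hQ; apply: runs_seq.
(* The accumulator is stored after every addition, so all partial sums must obey the bound. *)
have sumB m : m <= n -> h (\sum_(0 <= e < m | c e) inR (o + e))%R <= value_bound.
  move=> mn; apply: leq_trans (height_sum _ _ (fun i => hin (o + i))) _.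
  by rewrite /value_bound /sum_bound; nia.
apply: rset.
  by apply: leq_trans (height0 hh) value_bound_gt0.
pose Inv i V' (W' : nat -> K) := [/\ forall j : nat, j != 0 -> V' j = V j,
  forall a : nat, a != acc -> W' a = W a
  & W' acc = (\sum_(0 <= e < i | c e) inR (o + e))%R].
apply: (rfor (m := n) (Inv := Inv)).
- exact: ltnW.
- by move=> i V' W' _; rewrite iE.
- split; [by move=> j /negPf j0; rewrite /update j0
         |by move=> a /negPf aa; rewrite /update aa|].
  by rewrite big_geq // /update eqxx.
- move=> i V' W' im bW Vi [hV hW hacc].
  apply: rif.
  rewrite hg ?Vi //; case: ifP => ci.
    have e1 : reval (mk V' W') (RAdd (rloc (IConst acc)) (RGet (IAdd off (var 0))))
       = (\sum_(0 <= e < i.+1 | c e) inR (o + e))%R.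
      by rewrite sum_nat_recr ci -hacc !iE reval_in !iE hoff // Vi //; lia.
    apply: rset; first by rewrite e1 sumB.
    rewrite e1; split=> //; split.
    - by move=> j /[dup] /negPf j0 /hV <-; rewrite /update j0.
    - by move=> a /[dup] /negPf aa /hW <-; rewrite /update aa.
    - by rewrite /update eqxx.
  apply: runs_skip; split=> //; split=> //.
  - by move=> j /[dup] /negPf j0 /hV <-; rewrite /update j0.
  - by rewrite sum_nat_recr ci addr0.
- by move=> V' W' bW _ [hV hW hacc]; apply: hQ.
Qed.

Lemma covered_testE V W :
  beval (mk V W) (covered_test k) = covered k (fun j => V (10 + j)) (V 0).
Proof.
rewrite /covered; elim: k => [|k' IH]; first by [].
have -> : beval (mk V W) (covered_test k'.+1)
  = beval (mk V W) (covered_test k')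
    || (ieval (mk V W) (var (10 + (k' + k'))) <= ieval (mk V W) (var 0))
    && (ieval (mk V W) (IAdd (var 0) (IConst 1))
        <= ieval (mk V W) (var (10 + (k' + k').+1))) by [].
have -> : iota 0 k'.+1 = iota 0 k' ++ [:: k'] by rewrite -addn1 iotaD.
by rewrite IH !iE has_cat [has _ [:: _]]/= orbF addn1.
Qed.

Definition mun (e : nat) := inI (3 + e).
Definition od1 (d : nat) := inI (3 + (n + (d + d))).
Definition od2 (d : nat) := inI (4 + (n + (d + d))).
Definition on_route (d e : nat) : bool :=
  (od1 d <= e < od2 d) || (od2 d <= e < od1 d).

Lemma mun_testE V W : V 0 < n ->
  beval (mk V W) mun_test = (mun (V 0) == V 1).
Proof.
move=> hV; rewrite /mun_test /beval /teval !iE ieval_in !iE; last by rewrite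
  /ibase; lia.
by rewrite -eqn_leq.
Qed.

Lemma route_testE V W : V 1 < q ->
  beval (mk V W) route_test = on_route (V 1) (V 0).
Proof.
move=> hV; rewrite /route_test /beval /teval !iE !ieval_in !iE ?addn1 //;
  by rewrite /ibase; lia.
Qed.

Lemma eq_covered X Y e : X =1 Y -> covered k X e = covered k Y e.
Proof. by move=> XY; apply: eq_has => i; rewrite !XY. Qed.

Definition cost_in (X : nat -> nat) (m : nat) : K :=
  (\sum_(0 <= e < n | covered k X e && (mun e == m)) inR (0 + e))%R.

Definition budget_ratio (X : nat -> nat) (m : nat) : K :=
  (cost_in X m / inR (n + n + m))%R.

Definition budget_at (X : nat -> nat) : K := max_upto (budget_ratio X) M.

Definition improvement_at (c : nat -> bool) : K :=
  (\sum_(0 <= e < n | c e) inR (n + e))%R.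

Definition od_at (X : nat -> nat) (d : nat) : K :=
  let s := improvement_at (fun e => covered k X e && on_route d e) in
  match resp with
  | Linear => (inR (n + n + M + d) * (s / improvement_at (on_route d)))%R
  | MinImprov => if (inR (n + n + M + q + d) <= s)%R
                 then inR (n + n + M + d) else 0%R
  end.

Definition passengers_at (X : nat -> nat) : K :=
  (\sum_(0 <= d < q) od_at X d)%R.

Lemma height_budget_ratio X m : h (budget_ratio X m) <= sum_bound + A.
Proof.
apply: leq_trans (height_div hh _ _) _; apply: leq_add => //.
exact: (height_sum _ _ (fun i => hin (0 + i))).
Qed.

(** A maximum is a copy of one of its arguments, so the height does not grow with [m]. *)
Lemma height_max_upto g m C : 0 < C -> (forall i, h (g i) <= C) ->
  h (max_upto g m) <= C.
Proof.
move=> C0 hg; elim: m => [|m IH] /=; first exact: leq_trans (height0 hh) C0.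
by rewrite /Num.max; case: ifP.
Qed.

Lemma height_improvement_at c : h (improvement_at c) <= sum_bound.
Proof. exact: (height_sum _ _ (fun i => hin (n + i))). Qed.

Lemma height_od_at X d : h (od_at X d) <= A + (sum_bound + sum_bound).
Proof.
rewrite /od_at; case: resp.
  apply: leq_trans (heightM hh _ _) _; apply: leq_add => //.
  apply: leq_trans (height_div hh _ _) _.
  by apply: leq_add; apply: height_improvement_at.
case: ifP => _; first exact: leq_trans (hin _) (leq_addr _ _).
by apply: leq_trans (height0 hh) _; rewrite addn_gt0 A0.
Qed.

Lemma height_passengers X m : m <= q ->
  h (\sum_(0 <= d < m) od_at X d)%R <= value_bound.
Proof.
move=> mq; apply: leq_trans (height_sum xpredT m (height_od_at X)) _.
by rewrite /value_bound -addnA leq_add2l (leq_trans _ (leq_addr _ _)) //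
  leq_mul2r mq orbT.
Qed.

Lemma ratio_le_value_bound : sum_bound + A <= value_bound.
Proof. exact: leq_addl. Qed.

Lemma runs_budget V W (Q : (nat -> nat) -> (nat -> K) -> Prop) :
  (forall (V' : nat -> nat) W', (forall j : nat, 2 <= j -> V' j = V j) ->
     (forall a : nat, 3 <= a -> W' a = W a) ->
     W' 2 = budget_at (fun j => V (10 + j)) -> Q V' W') ->
  runs (budget_prog k) V W Q.
Proof.
set X := fun j => V (10 + j) => hQ.
apply: runs_seq; apply: rset.
  by apply: leq_trans (height0 hh) _.
pose Inv i (V' : nat -> nat) (W' : nat -> K) :=
  [/\ forall j : nat, 2 <= j -> V' j = V j,
      forall a : nat, 3 <= a -> W' a = W a & W' 2 = max_upto (budget_ratio X) i].
apply: (rfor (m := M) (Inv := Inv)) => //.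
- by rewrite !iE; split=> [[|[|j]]|[|[|[|a]]]|].
- move=> m V' W' mM bW Vm [hV hW hmax].
  apply: runs_seq.
  apply: (runs_sum (c := fun e => covered k X e && (mun e == m)) (o := 0)).
  + by rewrite /rbase; lia.
  + move=> V1 W1 h1 hn.
    rewrite beval_and covered_testE mun_testE // (h1 1) // Vm; congr (_ && _).
    by apply: eq_covered => j; rewrite h1 // hV.
  + by move=> V1 W1 _; rewrite iE.
  move=> V1 W1 hV1 hW1 hacc.
  have hq : reval (mk V1 W1) (RDiv (rloc (IConst 0)) (RGet (IAdd (IAdd eN eN)
    (var 1))))
    = budget_ratio X m.
    rewrite !iE reval_in !iE hV1 // Vm ?hacc //.
    by rewrite /rbase; lia.
  have W12 : W1 2 = max_upto (budget_ratio X) m by rewrite hW1.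
  have hV1' (j : nat) : 2 <= j -> V1 j = V j.
    by move=> j2; rewrite hV1 ?hV //; lia.
  have hW1' (a : nat) : 3 <= a -> W1 a = W a.
    by move=> j2; rewrite hW1 ?hW //; lia.
  apply: rif; rewrite bE hq !iE W12; case: ifP => hle.
    apply: rset; first by rewrite hq; apply: leq_trans (height_budget_ratio _
      _) ratio_le_value_bound.
    rewrite hq !iE; split; first by rewrite hV1.
    split=> [[|[|j]] // j2|[|[|[|a]]] // a2|]; [exact: hV1'|exact: hW1'|].
    by rewrite /update /= max_r.
  apply: runs_skip; split; first by rewrite hV1.
  split=> [[|[|j]] // j2|[|[|[|a]]] // a2|]; [exact: hV1'|exact: hW1'|].
  by rewrite /= max_l // ltW // ltNge hle.
- by move=> V' W' bW _ [hV hW hm]; apply: hQ.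
Qed.

Lemma runs_passengers V W (Q : (nat -> nat) -> (nat -> K) -> Prop) :
  (forall (V' : nat -> nat) W', (forall j : nat, 2 <= j -> V' j = V j) ->
     (forall a : nat, 2 <= a -> a != 3 -> W' a = W a) ->
     W' 3 = passengers_at (fun j => V (10 + j)) -> Q V' W') ->
  runs (passengers_prog resp k) V W Q.
Proof.
set X := fun j => V (10 + j) => hQ.
apply: runs_seq; apply: rset.
  by apply: leq_trans (height0 hh) _.
pose Inv i (V' : nat -> nat) (W' : nat -> K) :=
  [/\ forall j : nat, 2 <= j -> V' j = V j,
      forall a : nat, 2 <= a -> a != 3 -> W' a = W a
    & W' 3 = (\sum_(0 <= d < i) od_at X d)%R].
apply: (rfor (m := q) (Inv := Inv)) => //.
- rewrite !iE; split=> [[|[|j]]|[|[|[|[|a]]]]|] //.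
  by rewrite big_geq.
- move=> d V' W' dq bW Vd [hV hW hsum].
  apply: runs_seq.
  apply: (runs_sum (c := fun e => covered k X e && on_route d e) (o := n)).
  + by rewrite /rbase; lia.
  + move=> V1 W1 h1 hn.
    rewrite beval_and covered_testE route_testE (h1 1) // Vd //; congr (_ && _).
    by apply: eq_covered => j; rewrite h1 // hV.
  + by move=> V1 W1 _; rewrite iE.
  move=> V1 W1 hV1 hW1; rewrite -/(improvement_at _) => hacc.
  have V11 : V1 1 = d by rewrite hV1.
  have hV1' (j : nat) : 2 <= j -> V1 j = V j.
    by move=> j2; rewrite hV1 ?hV //; lia.
  have W13 : W1 3 = (\sum_(0 <= d < d) od_at X d)%R by rewrite hW1.
  have hW1' (a : nat) : 2 <= a -> a != 3 -> W1 a = W a.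
    by move=> j2 j3; rewrite hW1 ?hW //; lia.
  have stepE : (\sum_(0 <= d < d.+1) od_at X d
    = \sum_(0 <= d < d) od_at X d + od_at X d)%R by rewrite sum_nat_recr.
  have step e V2 W2 : V2 1 = d -> (forall j : nat, 2 <= j -> V2 j = V j) ->
      (forall a : nat, 2 <= a -> a != 3 -> W2 a = W a) ->
      W2 3 = (\sum_(0 <= d < d) od_at X d)%R ->
      reval (mk V2 W2) e = od_at X d ->
      runs (PR (IConst 3) (RAdd (rloc (IConst 3)) e)) V2 W2
        (fun V' W' => V' 1 = d /\ Inv d.+1 (update V' 1 d.+1) W').
    move=> V2d hV2 hW2 W23 he; apply: rset.
      by rewrite !iE he W23 -stepE height_passengers.
    rewrite !iE he W23 -stepE; split=> //.
    by split=> [[|[|j]] // j2|[|[|[|[|a]]]] // a2 a3|] //; [exact: hV2|exact: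
      hW2|exact: hW2].
  have demE V2 W2 : V2 1 = d ->
      reval (mk V2 W2) (RGet (IAdd (IAdd (IAdd eN eN) eM) (var 1))) = inR (n +
        n + M + d).
    by move=> V2d; rewrite reval_in !iE V2d // /rbase; lia.
  have thrE V2 W2 : V2 1 = d ->
      reval (mk V2 W2) (RGet (IAdd (IAdd (IAdd (IAdd eN eN) eM) eQ) (var 1))) =
        inR (n + n + M + q + d).
    by move=> V2d; rewrite reval_in !iE V2d // /rbase; lia.
  have odE : od_at X d =
      let s := improvement_at (fun e => covered k X e && on_route d e) in
      match resp with
      | Linear => (inR (n + n + M + d) * (s / improvement_at (on_route d)))%R
      | MinImprov => if (inR (n + n + M + q + d) <= s)%R
                     then inR (n + n + M + d) else 0%R
      end by [].
  case: resp odE => /= odE.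
    apply: runs_seq.
    apply: (runs_sum (c := on_route d) (o := n)).
    + by rewrite /rbase; lia.
    + move=> V2 W2 h1 hn.
      by rewrite route_testE (h1 1) // V11.
    + by move=> V2 W2 _; rewrite iE.
    move=> V2 W2 hV2 hW2; rewrite -/(improvement_at _) => hacc2.
    apply: step.
    + by rewrite hV2.
    + by move=> j j2; rewrite hV2 ?hV1' //; lia.
    + by move=> a a2 a3; rewrite hW2 ?hW1' //; lia.
    + by rewrite hW2.
    + by rewrite reval_mul demE ?hV2 // !iE hacc2 hW2 // hacc odE.
  apply: rif; rewrite bE thrE // !iE hacc; case: ifP => hle.
    by apply: step => //; rewrite demE // odE hle.
  apply: runs_skip; split=> //.
  split=> [[|[|j]] // j2|[|[|[|[|a]]]] // a2 a3|];
    [exact: hV1'|exact: hW1'|exact: hW1'|].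
  by rewrite /= W13 stepE odE hle addr0.
- by move=> V' W' bW _ [hV hW hm]; apply: hQ.
Qed.
Definition point (W : nat -> K) (i : nat) : K * K :=
  (W (4 + 0 + (i + i)), W (4 + 1 + (i + i))).

Definition stored (W : nat -> K) (a : nat) (s : seq (K * K)) : Prop :=
  forall i, i < size s -> point W (a + i) = nth (0%R, 0%R) s i.

Lemma stored_frame W W' a s m :
  (forall b, b < 4 + (m + m) -> W' b = W b) -> a + size s <= m ->
  stored W a s -> stored W' a s.
Proof.
move=> hW hm hs i im; rewrite -(hs i im) /point !hW //; lia.
Qed.

Lemma stored_rcons W a s z :
  stored W a s -> point W (a + size s) = z -> stored W a (rcons s z).
Proof.
move=> hs hz i; rewrite size_rcons ltnS nth_rcons.
by case: (ltngtP i (size s)) => // [/hs|->].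
Qed.

Lemma runs_push j e1 e2 (V : nat -> nat) W z
    (Q : (nat -> nat) -> (nat -> K) -> Prop) :
  reval (mk V W) e1 = z.1 ->
  (forall W', (forall b : nat, b < 4 + (V j + V j) -> W' b = W b) ->
     reval (mk V W') e2 = z.2) ->
  h z.1 <= value_bound -> h z.2 <= value_bound ->
  (forall W', (forall b : nat, b < 4 + (V j + V j) -> W' b = W b) ->
     point W' (V j) = z -> Q (update V j (V j).+1) W') ->
  runs (push_prog j e1 e2) V W Q.
Proof.
move=> h1 h2 b1 b2 hQ; apply: runs_seq; apply: rset; first by rewrite h1.
have fr a x (W' : nat -> K) : 4 + (V j + V j) <= a ->
    (forall b : nat, b < 4 + (V j + V j) -> W' b = W b) ->
    forall b : nat, b < 4 + (V j + V j) -> update W' a x b = W b.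
  by move=> ha hW' b hb; rewrite /update; case: eqP => [|_]; [lia|apply: hW'].
rewrite h1 !iE; apply: runs_seq; apply: rset.
  by rewrite h2 //; apply: fr => //; lia.
rewrite h2; last by apply: fr => //; lia.
apply: iset; rewrite !iE addn1; apply: hQ.
  by apply: (fr); [lia|apply: fr => //; lia].
rewrite /point /update eqxx; case: eqP => [|_]; first by lia.
by rewrite eqxx -surjective_pairing.
Qed.

Definition candidate (X : nat -> nat) : K * K :=
  (passengers_at X, budget_at X).

Lemma height_candidate X : h (candidate X).1 <= value_bound /\ h (candidate
  X).2 <= value_bound.
Proof.
split; first exact: height_passengers.
apply: height_max_upto => // i.
exact: leq_trans (height_budget_ratio _ _) ratio_le_value_bound.
Qed.

Lemma runs_candidate (V : nat -> nat) W s
    (Q : (nat -> nat) -> (nat -> K) -> Prop) :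
  stored W 0 s -> V 3 = size s ->
  (forall (V' : nat -> nat) W',
     (forall j : nat, 2 <= j -> j != 3 -> V' j = V j) ->
     V' 3 = (size s).+1 ->
     stored W' 0 (rcons s (candidate (fun j => V (10 + j)))) -> Q V' W') ->
  runs (candidate_prog resp k) V W Q.
Proof.
move=> hs V3 hQ; set X := fun j => V (10 + j) in hQ *.
apply: runs_seq; apply: runs_budget => V1 W1 hV1 hW1 hb.
apply: runs_seq; apply: runs_passengers => V2 W2 hV2 hW2 hp.
have eX : (fun j => V1 (10 + j)) = X.
  by apply: functional_extensionality => j; rewrite hV1.
have V23 : V2 3 = size s by rewrite hV2 // hV1.
have [c1 c2] := height_candidate X.
apply: (runs_push (z := candidate X)) => //.
- by rewrite !iE hp eX.
- by move=> W' hW'; rewrite !iE hW' // hW2 // hb.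
move=> W3 hW3 hpt; apply: hQ.
- by move=> j j2 /negPf j3; rewrite /update j3 hV2 ?hV1.
- by rewrite /update eqxx V23.
apply: stored_rcons; last by rewrite add0n -V23.
move=> i im; rewrite -(hs i im) /point; rewrite !hW3 ?V23; try lia.
by rewrite !hW2 ?hW1 //; lia.
Qed.

(** The coordinates above [j] are frozen by the outer loops, the [j]-th has run through the values
    below [x], and the lower ones are exhausted by the inner loops. *)
Definition explored (j x : nat) (Y : nat -> nat) (s : seq (K * K)) : Prop :=
  (forall z, z \in s -> exists X, z = candidate X) /\
  (forall X : nat -> nat, (forall i, j < i -> X i = Y i) ->
     (forall i, i < j -> X i <= n) -> X j < x -> candidate X \in s).

(** Generalized over the list found so far and over the outer coordinates, because the inner nest is
    rerun for each value of coordinate [j]. The count of new points later bounds the loops of the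
    filter. *)
Lemma runs_nest j (V : nat -> nat) W s :
  stored W 0 s -> V 3 = size s ->
  runs (nest j (candidate_prog resp k)) V W (fun V' W' => exists s',
    [/\ stored W' 0 (s ++ s'), V' 3 = size (s ++ s'), size s' = n.+1 ^ j,
        forall i : nat, j <= i -> V' (10 + i) = V (10 + i)
      & (forall z, z \in s' -> exists X, z = candidate X) /\
        (forall X : nat -> nat, (forall i, j <= i -> X i = V (10 + i)) ->
           (forall i, i < j -> X i <= n) -> candidate X \in s')]).
Proof.
elim: j V W s => [|j IH] V W s hs V3.
  apply: (runs_candidate hs V3) => V' W' hV' V'3 hs'.
  exists [:: candidate (fun j => V (10 + j))].
  rewrite cats1; split=> //; first by rewrite size_rcons.
  - by move=> i _; rewrite hV'.
  - split=> [z|X hX _]; first by rewrite inE => /eqP ->; eexists.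
    have -> : X = fun j => V (10 + j).
      by apply: functional_extensionality => i; apply: hX.
    exact: mem_head.
pose Inv x (V' : nat -> nat) (W' : nat -> K) := exists s',
    [/\ stored W' 0 (s ++ s'), V' 3 = size (s ++ s'), size s' = x * n.+1 ^ j,
        forall i : nat, j < i -> V' (10 + i) = V (10 + i)
      & explored j x (fun i => V (10 + i)) s'].
apply: (rfor (m := n.+1) (Inv := Inv)) => //.
- by move=> i V' W' _; rewrite !iE addn1.
- exists [::]; rewrite cats0; split=> //.
  by move=> i ji; rewrite /update eqn_add2l gtn_eqF.
- move=> x V' W' xn bW Vx [s1 [hs1 V31 z1 hV1 [snd1 cmp1]]].
  apply: runs_conseq (IH V' W' _ hs1 V31) _ => V2 W2 _ [s2 [hs2 V32 z2 hV2
    [snd2 cmp2]]].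
  split; first by rewrite hV2.
  exists (s1 ++ s2); rewrite catA; split=> //.
  + by rewrite size_cat z1 z2 mulSn addnC.
  + by move=> i ji; rewrite /update eqn_add2l gtn_eqF // hV2 ?hV1 // ltnW.
  split=> [z|X hX hXn]; first by rewrite mem_cat => /orP[/snd1|/snd2].
  rewrite ltnS leq_eqVlt mem_cat => /orP[/eqP Xx|Xx]; apply/orP; [right|left].
    apply: cmp2 => // i; rewrite leq_eqVlt => /orP[/eqP <-|ji]; first by
      rewrite Xx Vx.
    by rewrite hX // hV1.
  exact: cmp1.
- move=> V' W' bW _ [s1 [hs1 V31 z1 hV1 [snd1 cmp1]]].
  exists s1; split=> //; first by rewrite expnS.
  split=> // X hX hXn; apply: cmp1; rewrite ?ltnS ?hXn //.
  by move=> i /ltnW; apply: hXn.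
Qed.

Lemma dominates_testE V W i j :
  beval (mk V W) (dominates_test i j)
  = dominates (point W (V i)) (point W (V j)).
Proof. by rewrite !bE !iE. Qed.

Lemma runs_filter (V : nat -> nat) W s :
  stored W 0 s -> V 3 = size s -> size s <= L ->
  runs filter_prog V W (fun V' W' =>
    [/\ V' 3 = size s, V' 4 = size s + size (pareto s)
      & stored W' (size s) (pareto s)]).
Proof.
move=> hs V3 sL; set N := size s in V3 sL *.
pose keep i := ~~ has (dropped s i) (iota 0 N).
pose par m := [seq nth (0%R, 0%R) s i | i <- iota 0 m & keep i].
have parS m : par m.+1 = if keep m then rcons (par m) (nth (0%R, 0%R) s m) else
  par m.
  rewrite /par -addn1 iotaD filter_cat map_cat add0n /=.
  by case: (keep m); rewrite ?cats0 ?cats1.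
apply: runs_seq; apply: iset; rewrite iE.
pose Inv i (V' : nat -> nat) (W' : nat -> K) :=
  [/\ V' 3 = N, V' 4 = N + size (par i), stored W' 0 s & stored W' N (par i)].
apply: (rfor (m := N) (Inv := Inv)) => //.
- by move=> i V' W' [V'3 _ _ _]; rewrite iE.
- by split; rewrite /update //= V3 addn0.
- move=> i V1 W1 iN bW Vi [V13 V14 hs1 hp1].
  apply: runs_seq; apply: iset; rewrite iE.
  set V2 := update V1 2 0.
  pose Inv2 j (V' : nat -> nat) (W' : nat -> K) :=
    [/\ forall t : nat, t != 2 -> t != 6 -> V' t = V1 t,
        W' = W1 & V' 2 = has (dropped s i) (iota 0 j)].
  apply: runs_seq; apply: (rfor (m := N) (Inv := Inv2)) => //.
  + by move=> j V' W' [hV' _ _]; rewrite iE hV'.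
  + split=> // t /negPf t2 /negPf t6.
    by rewrite /update t6 /V2 /update t2.
  + move=> j V3' W3 jN _ Vj [hV3 -> hd].
    have testE : beval (mk V3' W1) (BAnd (dominates_test 6 5)
        (BOr (BNot (dominates_test 5 6))
             (BTest (ILe (IAdd (var 6) (IConst 1)) (var 5)))))
        = dropped s i j.
      rewrite beval_and beval_or beval_not beval_ile !dominates_testE !iE Vj
        hV3 // Vi addn1 /dropped.
      by rewrite -(hs1 i iN) -(hs1 j jN).
    have hasS : has (dropped s i) (iota 0 j.+1)
        = has (dropped s i) (iota 0 j) || dropped s i j.
      by rewrite -addn1 iotaD has_cat /= orbF.
    apply: rif; rewrite testE; case: ifP => dij.
      apply: iset; rewrite iE; split=> //; split=> //.
        move=> t /[dup] t2 /negPf t2' /[dup] t6 /negPf t6'.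
        by rewrite /update t6' t2' hV3.
      by rewrite hasS dij orbT.
    apply: runs_skip; split=> //; split=> //.
      by move=> t t2 /[dup] t6 /negPf t6'; rewrite /update t6' hV3.
    by rewrite hasS dij orbF.
  move=> V4 W4 bW4 _ [hV4 hW4 hd]; rewrite {}hW4 in bW4 *.
  have V45 : V4 5 = i by rewrite hV4.
  have V44 : V4 4 = N + size (par i) by rewrite hV4.
  apply: rif; rewrite bE !iE hd leqn0 eqb0 -/(keep i); case: ifP => ki.
    have hpt : point W1 i = nth (0%R, 0%R) s i by rewrite -(hs1 i iN).
    apply: (runs_push (z := nth (0%R, 0%R) s i)).
    * by rewrite !iE V45 -hpt.
    * by move=> W' hW'; rewrite !iE V45 -hpt hW' //; lia.
    (* Survivors are copied from memory cells, whose heights are bounded already. *)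
    * by rewrite -hpt; apply: bW4.
    * by rewrite -hpt; apply: bW4.
    rewrite V44 => W5 hW5 pt5.
    split; first by rewrite /update.
    split; rewrite ?parS ?ki //.
    * by rewrite /update /= hV4.
    * by rewrite /update /= size_rcons addnS.
    * by apply: stored_frame hs1; [exact: hW5|rewrite leq_addr].
    * by apply: stored_rcons pt5; apply: stored_frame hp1; first exact: hW5.
  apply: runs_skip; split=> //.
  by split; rewrite ?parS ?ki // /update /= ?hV4.
- by move=> V' W' _ _ [].
Qed.

Lemma runs_main (V : nat -> nat) :
  V 3 = 0 -> n.+1 ^ (k + k) <= L ->
  runs (main_prog resp k) V (fun=> 0%R) (fun V' W' => exists s,
    [/\ V' 3 = size s, V' 4 = size s + size (pareto s),
        stored W' (size s) (pareto s)
      & (forall z, z \in s -> exists X, z = candidate X) /\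
        (forall X : nat -> nat, (forall i, X i <= n) -> candidate X \in s)]).
Proof.
move=> V3 nkL; apply: runs_seq.
apply: runs_conseq (@runs_nest (k + k) V _ [::] _ V3) _ => //.
move=> V1 W1 _ [s [hs V13 zs _ [snd cmp]]].
rewrite cat0s in hs V13; rewrite -zs in nkL.
apply: runs_conseq (runs_filter hs V13 nkL) _ => V2 W2 _ [? ? ?].
exists s; split=> //; split=> // X hX.
(* The search is complete only for coordinates that agree with scratch memory from [k + k] on;
   [candidate] does not depend on these. *)
pose X' i := if i < k + k then X i else V (10 + i).
suff -> : candidate X = candidate X'.
  apply: cmp => i ik; rewrite /X'; last by rewrite ik.
  by rewrite ltnNge ik.
have cE e : covered k X e = covered k X' e.
  apply: eq_in_has => i; rewrite mem_iota /= /X' => ik.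
  by rewrite !ifT //; lia.
have eqs : covered k X = covered k X' by apply: functional_extensionality.
by rewrite /candidate /passengers_at /od_at /budget_at /budget_ratio /cost_in eqs.
Qed.

End Correctness.

(** * Pareto-optimal points *)

Section Pareto.
Variable K : realFieldType.
Implicit Types (s : seq (K * K)) (y z : K * K).

Lemma dominates_refl z : dominates z z.
Proof. by rewrite /dominates !lexx. Qed.

Lemma dominates_anti y z : dominates y z -> dominates z y -> y = z.
Proof.
case: y z => [a b] [c d] /andP[/= h1 h2] /andP[/= h3 h4].
by congr pair; apply: le_anti; rewrite ?h1 ?h2 ?h3 ?h4.
Qed.

Lemma mem_pareto s z :
  reflect (z \in s /\ forall y, y \in s -> dominates y z -> dominates z y)
          (z \in pareto s).
Proof.
apply: (iffP mapP) => [[i]|[zs hz]].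
  rewrite mem_filter mem_iota /= => /andP[/hasPn hi im] ->.
  split=> [|y ys yz]; first exact: mem_nth.
  have := hi (index y s); rewrite mem_iota /= index_mem => /(_ ys).
  by rewrite /dropped nth_index // yz /= negb_or negbK => /andP[].
(* The first occurrence of [z] survives: by antisymmetry, an index dropping it would be an even
   earlier occurrence. *)
exists (index z s); last by rewrite nth_index.
rewrite mem_filter mem_iota /= index_mem zs andbT; apply/hasPn => j.
rewrite mem_iota /= => jm; rewrite /dropped nth_index //.
apply/negP => /andP[jz]; have zj := hz _ (mem_nth _ jm) jz.
rewrite zj /= => /(before_find (0%R, 0%R)) /=.
by rewrite (dominates_anti jz zj) eqxx.
Qed.

Lemma pareto_uniq s : uniq (pareto s).
Proof.
rewrite map_inj_in_uniq ?filter_uniq ?iota_uniq // => i j.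
rewrite !mem_filter !mem_iota /= => /andP[/hasPn hi im] /andP[/hasPn hj jm] ij.
have no i' j' : i' < size s -> j' < i' -> ~~ dropped s i' j' ->
    nth (0%R, 0%R) s i' = nth (0%R, 0%R) s j' -> False.
  by move=> im' lt /[swap] e; rewrite /dropped e dominates_refl lt orbT.
case: (ltngtP i j) => // lt.
  by case: (no j i jm lt) => //; apply: hj; rewrite mem_iota.
by case: (no i j im lt) => //; apply: hi; rewrite mem_iota.
Qed.

End Pareto.

(** * Non-dominated points and the Pareto filter *)

Section Points.
Variables (R K : realFieldType) (f : {rmorphism K -> R}).
Hypothesis f_mono : {mono f : x y / (x <= y)%R}.
Variables (resp : response) (k : nat) (I : instance K).
Hypothesis I_valid : valid resp (map_instance f I).
Implicit Types F : {set 'I_(nseg I)}.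

Lemma map_lt : {mono f : x y / (x < y)%R}.
Proof. exact: leW_mono. Qed.

Lemma passengers_map F :
  passengers resp (I := map_instance f I) F = f (passengers resp F).
Proof.
have sumE (A : {set 'I_(nseg I)}) :
    (\sum_(e in A) @improvement R (map_instance f I) e)%R
    = f (\sum_(e in A) improvement e)%R by rewrite rmorph_sum.
rewrite /passengers rmorph_sum; apply: eq_bigr => d _.
rewrite /passengers_od; case: resp.
  by rewrite !sumE rmorphM fmorph_div rmorph_nat.
by rewrite sumE f_mono; case: ifP; rewrite ?rmorph_nat ?rmorph0.
Qed.

Definition mun_cost F (m : 'I_(nmun I)) : nat :=
  \sum_(e in F :&: seg m) cost e.

Lemma share_gt0 (m : 'I_(nmun I)) : (0 < share m)%R.
Proof. by rewrite -map_lt rmorph0; apply: (valid_share I_valid m). Qed.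

Lemma max_upto_le (g : nat -> K) m v :
  (f (max_upto g m) <= v)%R <->
  (0 <= v)%R /\ forall i, i < m -> (f (g i) <= v)%R.
Proof.
elim: m => [|m IH] /=; first by rewrite rmorph0; split=> [|[]].
have -> : (f (Num.max (max_upto g m) (g m)) <= v)%R
    = (f (max_upto g m) <= v)%R && (f (g m) <= v)%R.
  rewrite maxEle; case: ifP => h; [rewrite andbC|]; rewrite andb_idr //.
    by apply: le_trans; rewrite f_mono.
  by apply: le_trans; rewrite f_mono ltW // ltNge h.
split=> [/andP[/IH[v0 hv] hm]|[v0 hv]].
  by split=> // i; rewrite ltnS leq_eqVlt => /orP[/eqP ->|/hv].
apply/andP; split; last exact: hv.
by apply/IH; split=> // i /ltnW; apply: hv.
Qed.

(** Division by the positive share turns each budget constraint into a lower bound on [v]. The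
    function [g] is abstract because [max_upto] ranges over naturals, municipalities over
    ordinals. *)
Lemma feasibleE F v (g : nat -> K) :
  (forall m : 'I_(nmun I), g m = ((mun_cost F m)%:R / share m)%R) ->
  feasible k (I := map_instance f I) F v <->
  (f (max_upto g (nmun I)) <= v)%R /\ components F <= k.
Proof.
move=> hg; rewrite max_upto_le.
have mE (m : 'I_(nmun I)) : (f (g m) <= v)%R =
    ((\sum_(e in F :&: @seg _ (map_instance f I) m) @cost _ (map_instance f I) e)%:R
      <= @share _ (map_instance f I) m * v)%R.
  rewrite hg fmorph_div rmorph_nat ler_pdivrMr; last first.
    by rewrite -(rmorph0 f) map_lt share_gt0.
  by rewrite [X in (_ <= X)%R]mulrC.
split=> [[v0 hm hk]|[[v0 hm] hk]].
  by split=> //; split=> // i im; have := hm (Ordinal im); rewrite -mE.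
by split=> // m; rewrite -mE; apply: hm.
Qed.

Variable bud : {set 'I_(nseg I)} -> K.
Hypothesis feasP : forall F v, feasible k (I := map_instance f I) F v <->
  (f (bud F) <= v)%R /\ components F <= k.

(** Lowering [v] to the least budget of [F] would dominate any larger [v]; hence [v] lies in the
    image of [K] although it ranges over [R]. The other comparisons transfer along the order
    embedding [f]. *)
Lemma nondominated_pareto (s : seq (K * K)) z :
  (forall y, y \in s <->
     exists2 F, components F <= k & y = (passengers resp (I := I) F, bud F)) ->
  nondominated_point resp k (map_instance f I) z <->
  z \in [seq (f y.1, f y.2) | y <- pareto s].
Proof.
move=> hs; split=> [[F [v [Fv zE nd]]]|/mapP[y /mem_pareto[/hs[F Fk yE] hy] zE]].
  have [bv Fk] := (feasP F v).1 Fv.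
  have vE : v = f (bud F).
    apply/eqP; rewrite eq_sym eq_le bv /= leNgt; apply/negP => lt.
    by apply: nd; exists F, (f (bud F)); split; [exact/feasP|exact: lexx|exact:
      ltW|right].
  apply/mapP; exists (passengers resp (I := I) F, bud F); last first.
    by rewrite zE passengers_map vE.
  apply/mem_pareto; split=> [|y /hs[F' F'k ->] /andP[/= h1 h2]].
    by apply/hs; exists F.
  apply/negPn/negP => hnd; apply: nd; exists F', (f (bud F')).
  rewrite !passengers_map vE !f_mono !map_lt; split=> //.
    exact/feasP.
  by move: hnd; rewrite negb_and -!ltNge => /orP.
exists F, (f (bud F)); split.
- exact/feasP.
- by rewrite passengers_map zE yE.
move=> [F' [v' [/feasP[bv F'k] hp hv hlt]]].
have bb : (bud F' <= bud F)%R by rewrite -f_mono (le_trans bv).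
rewrite !passengers_map f_mono map_lt in hp hlt.
have := hy (passengers resp (I := I) F', bud F'); rewrite yE /dominates /= hp bb.
case/(_ _ isT)/andP; first by apply/hs; exists F'.
move=> p1 p2; case: hlt => [|lt]; first by rewrite ltNge p1.
have : (f (bud F') < f (bud F))%R by apply: le_lt_trans bv lt.
by rewrite map_lt ltNge p2.
Qed.

End Points.

(** * Reading the input *)

Section Input.
Variables (K : realFieldType) (resp : response) (I : instance K).
Local Notation n := (nseg I).
Local Notation M := (nmun I).
Local Notation q := #|od I|.
Local Notation inI := (nth 0 (index_input I)).
Local Notation inR := (nth 0%R (number_input resp I)).

Lemma nth_flatten_pairs (T : eqType) (a b : T -> nat) (x0 : T) s i :
  i < size s ->
  nth 0 (flatten [seq [:: a x; b x] | x <- s]) (i + i) = a (nth x0 s i) /\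
  nth 0 (flatten [seq [:: a x; b x] | x <- s]) (i + i).+1 = b (nth x0 s i).
Proof.
elim: s i => //= x s IH [|i] //= im.
by rewrite !addnS /=; apply: IH.
Qed.

Lemma size_flatten_pairs (T : eqType) (a b : T -> nat) s :
  size (flatten [seq [:: a x; b x] | x <- s]) = size s + size s.
Proof. by elim: s => //= x s ->; rewrite addnS. Qed.

Lemma size_index_input : size (index_input I) = ibase n q.
Proof.
by rewrite /index_input /= size_cat size_map size_enum_ord size_flatten_pairs
  -cardE.
Qed.

Lemma size_number_input : n + n + M <= size (number_input resp I) <= rbase n M q.
Proof.
have so : size (enum (od I)) = q by rewrite -cardE.
rewrite /number_input !size_cat !(so, size_enum_ord, size_map) /rbase.
by case: resp; rewrite ?(so, size_map) /=; lia.
Qed.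

(** Reading past either input list gives 0, so scratch memory starts at 0; for [Linear] the places
    reserved for thresholds read as 0 too. *)
Lemma input_stateE :
  input_state resp I = mk n M q inI inR (fun=> 0) (fun=> 0%R).
Proof.
rewrite /input_state /load; congr State; apply: functional_extensionality => a.
  by case: ltnP => // ha; rewrite nth_default // size_index_input.
case: ltnP => // ha; rewrite nth_default //.
by case/andP: size_number_input => _ h; apply: leq_trans h ha.
Qed.

Lemma mun_input (e : 'I_n) : mun inI e = municipality e.
Proof.
rewrite /mun /index_input /= nth_cat size_map size_enum_ord ltn_ord.
by rewrite (nth_map e) ?size_enum_ord ?add0n ?nth_ord_enum.
Qed.

Lemma od_input d0 d : d < q ->
  od1 n inI d = (nth d0 (enum (od I)) d).1 /\
  od2 n inI d = (nth d0 (enum (od I)) d).2.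
Proof.
rewrite cardE => dq.
have [h1 h2] := nth_flatten_pairs (fun d : 'I_n.+1 * 'I_n.+1 => d.1 : nat) (fun
  d => d.2 : nat) d0 dq.
have shift x : inI (3 + (n + x)) =
    nth 0 (flatten [seq [:: nat_of_ord d.1; nat_of_ord d.2] | d <- enum (od I)]) x.
  rewrite /index_input nth_cat ltnNge leq_addr addKn nth_cat.
  by rewrite size_map size_enum_ord ltnNge leq_addr addKn.
have e4 : 4 + (n + (d + d)) = 3 + (n + (d + d).+1) by lia.
by rewrite /od1 /od2 e4 !shift h1 h2.
Qed.

Lemma cost_input (e : 'I_n) : inR (0 + e) = ((cost e)%:R)%R.
Proof.
rewrite add0n /number_input nth_cat size_map size_enum_ord ltn_ord.
by rewrite (nth_map e) ?size_enum_ord ?add0n ?nth_ord_enum.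
Qed.

Lemma improvement_input (e : 'I_n) : inR (n + e) = improvement e.
Proof.
rewrite /number_input nth_cat size_map size_enum_ord ltnNge leq_addr addKn /=.
rewrite nth_cat size_map size_enum_ord ltn_ord.
by rewrite (nth_map e) ?size_enum_ord ?add0n ?nth_ord_enum.
Qed.

Lemma share_input (m : 'I_M) : inR (n + n + m) = share m.
Proof.
rewrite -addnA /number_input.
do 2 rewrite nth_cat size_map size_enum_ord ltnNge leq_addr addKn /=.
rewrite nth_cat size_map size_enum_ord ltn_ord.
by rewrite (nth_map m) ?size_enum_ord ?add0n ?nth_ord_enum.
Qed.

Lemma demand_input d0 d : d < q ->
  inR (n + n + M + d) = ((demand (nth d0 (enum (od I)) d))%:R)%R.
Proof.
rewrite cardE => dq; rewrite -!addnA /number_input.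
do 3 rewrite nth_cat size_map size_enum_ord ltnNge leq_addr addKn /=.
by rewrite nth_cat size_map dq (nth_map d0).
Qed.

Lemma threshold_input d0 d : resp = MinImprov -> d < q ->
  inR (n + n + M + q + d) = threshold (nth d0 (enum (od I)) d).
Proof.
move=> hr; rewrite cardE => dq; rewrite -!addnA /number_input hr.
do 3 rewrite nth_cat size_map size_enum_ord ltnNge leq_addr addKn /=.
by rewrite nth_cat size_map ltnNge leq_addr addKn /= (nth_map d0).
Qed.

Hypothesis disj : forall m m' : 'I_M, m != m' -> [disjoint seg m & seg m'].
Hypothesis cover : \bigcup_(m < M) seg m = [set: 'I_n].

(** Covering makes the search succeed, and disjointness makes its result the only municipality that
    contains [e]. *)
Lemma municipalityE (e : 'I_n) (m : 'I_M) : (municipality e == m) = (e \in seg m).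
Proof.
have /bigcupP[m0 _ em0] : e \in \bigcup_(m < M) seg m by rewrite cover inE.
have hs : has (fun m : 'I_M => e \in seg m) (enum 'I_M).
  by apply/hasP; exists m0; rewrite ?mem_enum.
have lt : municipality e < M by rewrite -[M in _ < M]size_enum_ord -has_find.
have em : e \in seg (Ordinal lt).
  have := nth_find m0 hs; rewrite -/(municipality e).
  by rewrite (_ : nth m0 _ _ = Ordinal lt) //; apply: val_inj; rewrite /=
    nth_enum_ord.
apply/eqP/idP => [me|ems].
  by rewrite (_ : m = Ordinal lt) //; apply: val_inj.
have [<- //|ne] := eqVneq (Ordinal lt) m.
by have /disjoint_setI0/setP/(_ e) := disj ne; rewrite !inE em ems.
Qed.

Variables (k : nat) (X : nat -> nat).
Local Notation F := (interval_set n k X).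

(** At most one of the two ranges in [on_route] is nonempty, according to the direction of
    travel. *)
Lemma on_routeE d0 d (e : 'I_n) : d < q ->
  on_route n inI d e = (e \in route (nth d0 (enum (od I)) d)).
Proof.
move=> dq; have [h1 h2] := od_input d0 dq.
rewrite /on_route h1 h2 inE; case: (nth d0 _ d) => x y /=; lia.
Qed.

Lemma sum_nat_set (c : nat -> bool) (A : {set 'I_n}) (o : nat) (F : 'I_n -> K) :
  (forall e : 'I_n, c e = (e \in A)) -> (forall e : 'I_n, inR (o + e) = F e) ->
  (\sum_(0 <= e < n | c e) inR (o + e) = \sum_(e in A) F e)%R.
Proof. by move=> hc hF; rewrite big_mkord; apply: eq_big. Qed.

Lemma cost_inE (m : 'I_M) : cost_in k n inI inR X m = ((mun_cost F m)%:R)%R.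
Proof.
rewrite /cost_in (@sum_nat_set _ (F :&: seg m) 0 (fun e => (cost e)%:R)%R).
- by rewrite natr_sum.
- by move=> e; rewrite mun_input municipalityE !inE.
- exact: cost_input.
Qed.

Lemma budget_ratioE (m : 'I_M) :
  budget_ratio k n inI inR X m = ((mun_cost F m)%:R / share m)%R.
Proof. by rewrite /budget_ratio cost_inE share_input. Qed.

Lemma passengers_atE :
  passengers_at resp k n M q inI inR X = passengers resp (I := I) F.
Proof.
rewrite /passengers_at /passengers -big_enum.
case E: (enum (od I)) => [|d0 s0].
  by rewrite cardE E big_geq // big_nil.
rewrite -E (big_nth d0) cardE !big_mkord; apply: eq_bigr => -[d /= dq] _.
rewrite -cardE in dq *; set dd := nth d0 _ d.
have h1 : improvement_at n inR (fun e => covered k X e && on_route n inI d e)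
    = (\sum_(e in F :&: route dd) improvement e)%R.
  apply: sum_nat_set; last exact: improvement_input.
  by move=> e; rewrite (on_routeE d0) // !inE.
have h2 : improvement_at n inR (on_route n inI d)
    = (\sum_(e in route dd) improvement e)%R.
  by apply: sum_nat_set; [move=> e; apply: on_routeE|exact: improvement_input].
rewrite /od_at /passengers_od /= h1 h2 (demand_input d0) //.
by move: (@threshold_input d0 d); case: resp => // ->.
Qed.

End Input.

(** * Announcing the output and the final cost estimate *)

Definition announce_cost : nat :=
  ((icost (IConst 1) + icost (IAdd eRB (point_addr 0 3))).+1
   + (icost (IConst 0) + icost (ISub (var 4) (var 3))).+1).+1.

Lemma announce_exec (K : realFieldType) (sz : K -> nat) n M q inI inR
    (V : nat -> nat) (W : nat -> K) (s : seq (K * K)) :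
  inI 0 = n.+1 -> inI 1 = M -> inI 2 = q ->
  V 4 = V 3 + size s -> stored W (V 3) s ->
  exists2 s', exec sz announce (mk n M q inI inR V W) announce_cost s'
    & output s' = s.
Proof.
move=> hI0 hI1 hI2 V4 hs.
pose x := rbase n M q + (4 + 0 + (V 3 + V 3)).
have e1 : ieval (mk n M q inI inR V W) (IAdd eRB (point_addr 0 3)) = x.
  by rewrite ieval_add ieval_eRB // /point_addr !ieval_add ieval_const !ieval_var.
(* The write to cell 1 is viewed as a change of the input; [ieval_var] still applies, as it relies
   on cells 0 and 2 only. *)
have e2 : State (update (imem (mk n M q inI inR V W)) 1 x) (rmem (mk n M q inI
  inR V W))
    = mk n M q (update inI 1 x) inR V W.
  congr State; apply: functional_extensionality => a; rewrite /update /=.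
  by case: eqP => // ->.
exists (State (update (imem (mk n M q (update inI 1 x) inR V W)) 0 (size s))
              (rmem (mk n M q inI inR V W))).
  apply: (ExecSeq (s2 := mk n M q (update inI 1 x) inR V W)).
    have := ExecISet sz (mk n M q inI inR V W) (IConst 1) (IAdd eRB (point_addr
      0 3)).
    by rewrite e1 ieval_const e2.
  have -> : size s = ieval (mk n M q (update inI 1 x) inR V W) (ISub (var 4)
    (var 3)).
    by rewrite ieval_sub !ieval_var // V4 addKn.
  exact: (ExecISet sz (mk n M q (update inI 1 x) inR V W) (IConst 0)).
rewrite /output -[RHS](mkseq_nth (0%R, 0%R)) /mkseq.
apply/eq_in_map => i; rewrite mem_iota /= => im.
rewrite -(hs i im) /point.
have rE y : rmem (mk n M q inI inR V W) (rbase n M q + y) = W y.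
  by rewrite /= ltnNge leq_addr addKn.
by congr pair; rewrite -[RHS]rE; apply: (congr1 (rmem (mk n M q inI inR V W)));
  rewrite /update /x /=; lia.
Qed.

Lemma leq_expl m m' e : m <= m' -> m ^ e <= m' ^ e.
Proof. by case: e => // e mm; rewrite leq_exp2r. Qed.

Lemma eq_max_upto (K : realFieldType) (g g' : nat -> K) m :
  (forall i, i < m -> g i = g' i) -> max_upto g m = max_upto g' m.
Proof.
elim: m => //= m IH h; rewrite IH ?h // => i im.
by apply: h; apply: ltnW.
Qed.

Section Solver.
Variables (R K : realFieldType) (f : {rmorphism K -> R}).
Hypothesis f_mono : {mono f : x y / (x <= y)%R}.
Variables (sz h : K -> nat).
Hypothesis hh : height sz h.

Lemma leq_sum_mem (T : eqType) (g : T -> nat) (s : seq T) x :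
  x \in s -> g x <= \sum_(y <- s) g y.
Proof. by move=> xs; rewrite (big_rem x) //= leq_addr. Qed.

(** Every number has positive size, so [S] also bounds the number of municipalities. A height is at
    most twice a size, which is a summand of [S]; the 1 is for zeros read beyond the list. *)
Lemma input_sizes resp (I : instance K) :
  let S := input_size resp I sz in
  [/\ (nseg I).+1 <= S, nmun I <= S, #|od I| <= S
    & forall a, h (nth 0%R (number_input resp I) a) <= 1 + 2 * S].
Proof.
move=> S.
have s1 : (nseg I).+1 <= S.
  by rewrite /S /input_size size_index_input /ibase; lia.
have s2 : #|od I| <= S.
  by rewrite /S /input_size size_index_input /ibase; lia.
have s3 : size (number_input resp I) <= S.
  rewrite -sum1_size; apply: leq_trans (leq_addl _ _).
  by apply: leq_sum => x _; apply: size_gt0 hh _.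
split=> //.
  have := size_number_input resp I; move: s3; lia.
move=> a; have [am|am] := ltnP a (size (number_input resp I)); last first.
  by rewrite nth_default //; apply: leq_trans (height0 hh) _.
apply: leq_trans (height_le_size hh _) _; apply: leq_trans (leq_addl _ _).
rewrite leq_mul2l /=; apply: leq_trans (leq_addl _ _).
exact/leq_sum_mem/mem_nth.
Qed.

Lemma solver_correct resp k :
  solves_in_poly_time f sz resp k (solver resp k).
Proof.
have [a0 [b0 hcost]] := pcost_poly (main_prog resp k).
(* Heights are at most [20 * S ^ 3] and [L.+1] is at most [5 * S ^ (k + k).+1]; the product of these
   bounds is raised to the power [b0] given by [pcost_poly]. *)
exists (a0 * 100 ^ b0 + announce_cost.+1), ((3 + (k + k).+1) * b0) => I I_valid.
set S := input_size resp I sz.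
have [nS MS qS hin] := input_sizes resp I.
rewrite -/S in nS MS qS hin.
set n := nseg I in nS; set M := nmun I in MS; set q := #|od I| in qS.
pose inI := nth 0 (index_input I); pose inR := nth 0%R (number_input resp I).
pose A := 1 + 2 * S.
(* A sum serves as common bound for all loop limits: stations, segments, municipalities, OD pairs
   and candidates. *)
pose L := n.+1 ^ (k + k) + n + M + q + 1.
have hI0 : inI 0 = n.+1 by [].
have hI1 : inI 1 = M by [].
have hI2 : inI 2 = q by [].
have nL : n < L by rewrite /L; lia.
have ML : M <= L by rewrite /L; lia.
have qL : q <= L by rewrite /L; lia.
have kL : n.+1 ^ (k + k) <= L by rewrite /L; lia.
have W0 : bnd h (value_bound n q A) (fun=> 0%R : K).
  by move=> a; apply: leq_trans (height0 hh) _.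
have [t [V [W [ht lt _ [s [V3 V4 hs [snd cmp]]]]]]] :=
  @runs_main K sz h hh resp k n M q inI inR hI0 hI1 hI2 A L isT hin nL ML qL
    (fun=> 0) erefl kL W0.
rewrite -V3 in V4 hs.
have [s' hs' out] := @announce_exec K sz n M q inI inR V W (pareto s) hI0 hI1
  hI2 V4 hs.
exists (t + announce_cost).+1, s'; split.
- by apply: ExecSeq hs'; rewrite input_stateE.
- have S0 : 0 < S by lia.
  have S1 m m' : m <= m' -> S ^ m <= S ^ m' by move=> mm; rewrite leq_pexp2l.
  have BS : value_bound n q A <= 20 * S ^ 3.
    rewrite /value_bound /sum_bound /A.
    have nA : n * (1 + 2 * S) <= S * (3 * S) by rewrite leq_mul //; lia.
    have qA : q * (1 + 2 * S + (1 + n * (1 + 2 * S) + (1 + n * (1 + 2 * S))))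
        <= S * (5 * S + 6 * (S * S)) by apply: leq_mul => //; nia.
    apply: (@leq_trans (1 + S * (5 * S + 6 * (S * S)) + (1 + S * (3 * S) + (1 +
      2 * S)))).
      by lia.
    by rewrite !expnS expn0; nia.
  have LS : L.+1 <= 5 * S ^ (k + k).+1.
    have h1 : n.+1 ^ (k + k) <= S ^ (k + k).+1.
      by apply: leq_trans (S1 _ _ (leqnSn _)); exact: leq_expl.
    have h2 : S <= S ^ (k + k).+1 by rewrite -{1}(expn1 S) S1.
    by rewrite /L; lia.
  have BL : value_bound n q A * L.+1 <= 100 * S ^ (3 + (k + k).+1).
    by apply: leq_trans (leq_mul BS LS) _; rewrite expnD mulnACA.
  have tS : t <= a0 * 100 ^ b0 * S ^ ((3 + (k + k).+1) * b0).
    apply: leq_trans lt _; apply: leq_trans (hcost _ _ (value_bound_gt0 _ _ _)) _.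
    by rewrite expnM -mulnA -expnMn leq_mul2l leq_expl ?orbT.
  have : 0 < S ^ ((3 + (k + k).+1) * b0) by rewrite expn_gt0 S0.
  by move=> P0; rewrite mulnDl -addnS leq_add // leq_pmulr.
- by rewrite out pareto_uniq.
have seg_disj : forall m m' : 'I_(nmun I), m != m' -> [disjoint seg m & seg m'].
  exact: valid_seg_disjoint I_valid.
have seg_cover : \bigcup_(m < nmun I) seg m = [set: 'I_(nseg I)].
  exact: valid_seg_cover I_valid.
pose g (F : {set 'I_(nseg I)}) (m : nat) : K :=
  if insub m is Some m' then ((mun_cost F m')%:R / share m')%R else 0%R.
have gE F (m : 'I_(nmun I)) : g F m = ((mun_cost F m)%:R / share m)%R.
  by rewrite /g valK.
have candE X : candidate resp k n M q inI inR X =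
    (passengers resp (I := I) (interval_set n k X),
     max_upto (g (interval_set n k X)) M).
  rewrite /candidate passengers_atE; congr pair.
  apply: eq_max_upto => m mM; rewrite -[m]/(val (Ordinal mM)) gE.
  exact: budget_ratioE.
move=> z; rewrite out.
apply: (nondominated_pareto f_mono (bud := fun F => max_upto (g F) M)) => //.
  by move=> F v; apply: feasibleE I_valid _ _ _ _.
move=> y; split=> [/snd[X ->]|[F Fk ->]].
  by exists (interval_set n k X); [apply: components_interval_set|apply: candE].
by have [X Xn <-] := interval_set_surj Fk; rewrite -candE; apply: cmp.
Qed.

End Solver.

(* One program per response and [k]: polynomially many unit-cost operations on
   real data, and polynomial bit cost on rational data. *)
Theorem theorem14 (R : realType) (resp : response) (k : nat) (hk : (0 < k)%N) :
  exists P : cmd,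
    @solves_in_poly_time R R id (fun _ => 1%N) resp k P
    /\ @solves_in_poly_time R rat ratr rat_bits resp k P.
Proof.
exists (solver resp k); split.
  exact: (@solver_correct R R idfun _ _ _ (unit_height_spec R)).
exact: (@solver_correct R rat ratr (ler_rat R) _ _ rat_height_spec).
Qed.
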